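(* Let $A$ be a real $m\times n$ matrix with rank $n$, let $1\le k\le n$, and let $S$ be a $k\times m$ Gaussian matrix. Let $P=(SA)^\dagger SA$. Then the smallest eigenvalue of $\mathbb{E}[P]$ satisfies $$\lambda_{\min}(\mathbb{E}[P])\ \ge\ (1-\epsilon)\,\frac{k\,\sigma_{\min}^2(A)}{\mathrm{Err}(A,k-1)}\qquad\text{for some }\epsilon\ \text{ with }\ \epsilon\le \frac{4k}{n}+\frac{8\log(3n)}{n}.$$
   Context: A Gaussian matrix is a random matrix with i.i.d. standard normal $N(0,1)$ entries. $(\cdot)^\dagger$ is the Moore-Penrose pseudoinverse, $\sigma_{\min}(A)$ is the smallest singular value of $A$, and $\|\cdot\|_F$ is the Frobenius norm. For an integer $j\ge 0$, $\mathrm{Err}(A,j):=\mathbb{E}\,\|A(I-(S'A)^\dagger S'A)\|_F^2$, where $S'$ is a $j\times m$ Gaussian matrix; in particular $\mathrm{Err}(A,0)=\|A\|_F^2$. *)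

(* Defs.v *)
From HB Require Import structures.
From mathcomp Require Import all_boot all_order all_algebra.
From mathcomp Require Import all_classical all_reals all_analysis.

Set Implicit Arguments.
Unset Strict Implicit.
Unset Printing Implicit Defensive.

Import Order.TTheory GRing.Theory Num.Theory.

Local Open Scope classical_set_scope.
Local Open Scope ring_scope.

Definition frob_norm (R : realType) m n (A : 'M[R]_(m, n)) : R :=
  Num.sqrt (\sum_(i < m) \sum_(j < n) A i j ^+ 2).

Definition is_pinv (R : realType) m n (A : 'M[R]_(m, n)) (X : 'M[R]_(n, m)) :=
  [/\ A *m X *m A = A, X *m A *m X = X,
      (A *m X)^T = A *m X & (X *m A)^T = X *m A].

(* The default value 0 is never used: see pinvP and is_pinv_uniq. *)
Definition pinv (R : realType) m n (A : 'M[R]_(m, n)) : 'M[R]_(n, m) :=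
  xget 0 [set X | is_pinv A X].

Lemma is_pinv_uniq (R : realType) m n (A : 'M[R]_(m, n)) (X Y : 'M[R]_(n, m)) :
  is_pinv A X -> is_pinv A Y -> X = Y.
Proof.
move=> [X1 X2 X3 X4] [Y1 Y2 Y3 Y4].
have AXY : A *m X = A *m Y.
  by rewrite -X3 -{1}Y1 -mulmxA trmx_mul X3 Y3 mulmxA X1.
have XAY : X *m A = Y *m A.
  by rewrite -X4 -{1}Y1 -mulmxA mulmxA trmx_mul Y4 X4 -mulmxA mulmxA -(mulmxA Y)
    (mulmxA A) X1.
by rewrite -X2 XAY -mulmxA AXY mulmxA Y2.
Qed.

Lemma gram_unitmx (R : realType) r n (F : 'M[R]_(r, n)) :
  row_free F -> F *m F^T \in unitmx.
Proof.
move=> Ff; rewrite -row_free_unit; apply: inj_row_free => v vFF.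
have : (v *m F) *m (v *m F)^T = 0.
  by rewrite trmx_mul mulmxA -(mulmxA v) vFF mul0mx.
move=> /matrixP/(_ 0 0); rewrite !mxE => /eqP.
rewrite psumr_eq0; last first.
  by move=> i _; rewrite [_^T _ _]mxE -expr2 sqr_ge0.
move=> /allP w0; apply: (row_free_inj Ff); rewrite mul0mx; apply/rowP => j.
have := w0 j (mem_index_enum _); rewrite [_^T _ _]mxE -expr2 sqrf_eq0 => /eqP ->.
by rewrite mxE.
Qed.

Lemma pinvP (R : realType) m n (A : 'M[R]_(m, n)) : is_pinv A (pinv A).
Proof.
apply: (@xgetPex _ 0 [set X | is_pinv A X]) => /=.
have Fu : row_base A *m (row_base A)^T \in unitmx.
  by apply: gram_unitmx; exact: row_base_free.
have Cu : (col_base A)^T *m col_base A \in unitmx.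
  rewrite -{2}[col_base A]trmxK; apply: gram_unitmx.
  by rewrite /row_free mxrank_tr; exact: col_base_full.
have symV k (M : 'M[R]_k) : M^T = M -> (invmx M)^T = invmx M.
  by move=> MT; rewrite trmx_inv MT.
move: (mulmx_base A) Fu Cu; move: (col_base A) (row_base A).
move: (\rank A) => r C F <- Fu Cu.
have FFT : (F *m F^T)^T = F *m F^T by rewrite trmx_mul trmxK.
have CCT : (C^T *m C)^T = C^T *m C by rewrite trmx_mul trmxK.
exists (F^T *m invmx (F *m F^T) *m (invmx (C^T *m C) *m C^T)).
set G := invmx (F *m F^T); set H := invmx (C^T *m C).
have FG : F *m (F^T *m G) = 1%:M by rewrite mulmxA mulmxV.
have HC : (H *m C^T) *m C = 1%:M by rewrite -mulmxA mulVmx.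
have AX : C *m F *m (F^T *m G *m (H *m C^T)) = C *m (H *m C^T).
  by rewrite -!mulmxA (mulmxA F^T) (mulmxA F) FG mul1mx.
have XA : F^T *m G *m (H *m C^T) *m (C *m F) = F^T *m G *m F.
  by rewrite -(mulmxA (F^T *m G)) (mulmxA _ C) HC mul1mx.
split; rewrite ?AX ?XA.
- by rewrite -mulmxA (mulmxA _ C) HC mul1mx.
- by rewrite -(mulmxA _ F) (mulmxA F) FG mul1mx.
- by rewrite !trmx_mul trmxK (symV _ _ CCT) mulmxA.
- by rewrite !trmx_mul trmxK (symV _ _ FFT) mulmxA.
Qed.

(* Meant for symmetric M of positive size, whose set of real eigenvalues is
   finite and nonempty, so that the infimum is a minimum. *)
Definition lambda_min (R : realType) n (M : 'M[R]_n) : R :=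
  inf [set a | eigenvalue M a].

Definition singular_value (R : realType) m n (A : 'M[R]_(m, n)) (s : R) :=
  0 <= s /\ exists (u : 'cV[R]_m) (v : 'cV[R]_n),
    [/\ frob_norm u = 1, frob_norm v = 1, A *m v = s *: u & A^T *m u = s *: v].

Definition sigma_min (R : realType) m n (A : 'M[R]_(m, n)) : R :=
  inf [set s | singular_value A s].

Section random_matrices.
Context d (T : measurableType d) (R : realType) (Pr : probability T R).

Definition mutually_independent (I : finType) (X : I -> {RV Pr >-> R}) :=
  forall (J : {set I}) (B : I -> set R),
    (forall i, i \in J -> measurable (B i)) ->
    Pr (\bigcap_(i in [set` J]) (X i @^-1` B i)) =
    (\prod_(i in J) Pr (X i @^-1` B i))%E.

Definition gaussian_mx k m (S : 'I_k -> 'I_m -> {RV Pr >-> R}) :=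
  (forall i j (B : set R), measurable B ->
     distribution Pr (S i j) B = normal_prob 0 1 B) /\
  mutually_independent (fun p : 'I_k * 'I_m => S p.1 p.2).

Definition rmx k m (S : 'I_k -> 'I_m -> {RV Pr >-> R}) (w : T) : 'M[R]_(k, m) :=
  \matrix_(i, j) S i j w.

(* fine sends infinite expectations to 0; it is only used on bounded random
   variables below, the matrices B^+ B and I - B^+ B being orthogonal
   projections. *)
Definition expectation_mx m n (M : T -> 'M[R]_(m, n)) : 'M[R]_(m, n) :=
  \matrix_(i, j) fine 'E_Pr[fun w => M w i j].

Definition sketch_proj k m n (S : 'I_k -> 'I_m -> {RV Pr >-> R})
    (A : 'M[R]_(m, n)) (w : T) : 'M[R]_n :=
  pinv (rmx S w *m A) *m (rmx S w *m A).

(* For Gaussian S this depends only on A and the number j of rows of S, since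
   the joint law of the entries of S is then determined. *)
Definition Err j m n (A : 'M[R]_(m, n)) (S : 'I_j -> 'I_m -> {RV Pr >-> R}) : R :=
  fine 'E_Pr[fun w => frob_norm (A *m (1%:M - sketch_proj S A w)) ^+ 2].

End random_matrices.

(* Main.v *)
(* Write A^T A = V diag(s_i^2) V^T and P_t = X^T (X X^T + t)^-1 X for X = S A and t > 0, so that P_t
   increases to P as t decreases to 0. Reflecting S along the left singular vectors leaves its law
   unchanged, hence V diagonalizes E[P] and it suffices to bound E[v^T P v] below for a right singular
   vector v with singular value s.

   By orthogonal invariance X v = s g with g standard Gaussian and independent of W = Y Y^T + t, where
   Y = X (1 - v v^T), and v^T P_t v = y / (1 + y) with y = s^2 g^T W^-1 g. Given W, y has mean
   z = s^2 tr W^-1 and second moment at most 3 z^2, so E[y / (1 + y) | W] >= 1 / (3 + 1 / z). Moreover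
   k^2 <= (\sum_l q_l) tr W^-1, where q_l is the ridge residual of row l of X on the other k - 1 rows,
   and E q_l is t plus the regularized version of Err(A, k - 1). Letting t tend to 0,
   E[v^T P v] >= 1 / (3 + Err / (k s^2)) >= q (1 - 3 q) for q = k sigma_min^2 / Err. As
   Err >= (n - k + 1) sigma_min^2, 3 q <= 4 k / n unless the claimed bound is negative. *)

Require Import Defs.
From HB Require Import structures.
From mathcomp Require Import all_boot all_order all_algebra.
From mathcomp Require Import all_classical all_reals all_analysis measurable_realfun.
From mathcomp Require Import ring lra.
From mathcomp Require Import complex.

Set Implicit Arguments.
Unset Strict Implicit.
Unset Printing Implicit Defensive.

Import Order.TTheory GRing.Theory Num.Theory.
Import numFieldNormedType.Exports.

Local Open Scope classical_set_scope.
Local Open Scope ring_scope.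

(** * One-dimensional Gaussian integrals *)

(** The regularization [t > 0] lets the argument run on an arbitrary probability space:
    [invmx (gram X t)] is a rational function of the entries, hence measurable, and no outcome of
    deficient rank has to be set aside as a null set. The pseudoinverse is reached through an
    explicit error bound of order [t] ([pinv_rproj]). Conditioning is replaced by resampling: one
    row or one column of the sketch is exchanged for an independent copy living on the second factor
    of a product space, and Fubini integrates the copy with the rest frozen. Rotation invariance is
    assembled from plane rotations and sign changes, and so comes with the construction of each
    orthogonal matrix that carries a given unit vector to the first basis vector. The constant 3 is
    the ratio of the fourth moment of a centred Gaussian to the square of its second moment. The
    nonlinear functions [y / (1 + y)] and [1 / x] are each bounded below by expressions with a free
    parameter ([b], then [c]) that are linear in the quantities to be averaged; the parameter is set
    at the optimum of the averaged bound. *)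

Definition push_measure d d' (T1 : measurableType d) (T2 : measurableType d')
    (R : realType) (m : {measure set T1 -> \bar R}) (f : T1 -> T2)
    (mf : measurable_fun setT f) : {measure set T2 -> \bar R} :=
  measure_function_pushforward__canonical__measure_function_Measure m mf.

(** Infinite [x] and [y] are covered: multiplication by a positive real preserves and reflects the
    order of the extended reals. *)
Lemma pmule_inj (R : realDomainType) (r : R) (x y : \bar R) :
  0 < r -> (r%:E * x = r%:E * y -> x = y)%E.
Proof.
move=> r0 E; have M := @lee_pmul2l _ r%:E isT r0.
have xy := M x y; have yx := M y x; move: xy yx; rewrite E lexx => xy yx.
by apply/eqP; rewrite eq_le -xy -yx.
Qed.

Section LebesgueAffine.
Context {R : realType}.
Notation leb := (@lebesgue_measure R).
Local Open Scope ereal_scope.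

Let measurable_affine (a b : R) :
  measurable_fun setT (fun x : measurableTypeR R => (a * x + b)%R : measurableTypeR R).
Proof. by apply: measurable_funD => //; exact: measurable_funM. Qed.

(** By uniqueness of Lebesgue measure: the pushforward scaled by [|a|] gives each half-open interval
    its length. For negative [a] the preimage of an interval closed on the right is closed on the
    left, hence the two cases. *)
Lemma lebesgue_measure_affine (a b : R) (A : set R) : a != 0%R -> measurable A ->
  leb A = `|a|%R%:E * leb ((fun x : R => a * x + b)%R @^-1` A).
Proof.
move=> a0 mA.
pose m : {measure set _ -> \bar R} :=
  mscale (NngNum (normr_ge0 a)) (push_measure leb (measurable_affine a b)).
rewrite (@lebesgue_measure_unique R m) //= => _ [[u v]] _ <-.
rewrite /m /mscale/= /pushforward.
have [ap|an] : (0 < a \/ a < 0)%R by apply/orP; rewrite orbC -neq_lt.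
- rewrite (_ : _ @^-1` _ = `](u - b) / a, (v - b) / a]%classic)%R; last first.
    apply/seteqP; split => x /=; rewrite !in_itv/= ltr_pdivrMr// ler_pdivlMr//;
    rewrite [(x * a)%R]mulrC ltrBlDr lerBrDr => //.
  rewrite !lebesgue_measure_itv/= !lte_fin ltr_pdivrMr// divfK// ltrD2r.
  case: ifPn => _; rewrite ?mule0// -!EFinD -EFinM; congr (_%:E).
  by rewrite gtr0_norm// -mulrBl [RHS]mulrC divfK//; ring.
- rewrite (_ : _ @^-1` _ = `[(v - b) / a, (u - b) / a[%classic)%R; last first.
    apply/seteqP; split => x /=; rewrite !in_itv/= ltr_ndivlMr// ler_ndivrMr//;
    rewrite [(x * a)%R]mulrC ltrBlDr lerBrDr andbC => //.
  rewrite !lebesgue_measure_itv/= !lte_fin ltr_ndivlMr// divfK ?lt_eqF// ltrD2r.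
  case: ifPn => _; rewrite ?mule0// -!EFinD -EFinM; congr (_%:E).
  by rewrite ltr0_norm// -mulrBl mulrC mulrN divfK ?lt_eqF//; ring.
Qed.

Lemma ge0_integral_affine (a b : R) (f : R -> \bar R) : a != 0%R ->
  measurable_fun setT f -> (forall x, 0 <= f x) ->
  \int[leb]_x f x = `|a|%R%:E * \int[leb]_x f (a * x + b)%R.
Proof.
move=> a0 mf f0.
pose phi := (fun x : measurableTypeR R => (a * x + b)%R : measurableTypeR R).
pose m : {measure set _ -> \bar R} :=
  mscale (NngNum (normr_ge0 a)) (push_measure leb (measurable_affine a b)).
transitivity (\int[m]_x f x).
  by apply: eq_measure_integral => A mA _; exact: lebesgue_measure_affine.
rewrite /m ge0_integral_mscale//=; congr (_ * _).
by rewrite ge0_integral_pushforward//; exact: measurable_affine.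
Qed.

(* A rotation with [s != 0] factors into two affine substitutions, each acting on one variable. *)
Lemma lebesgue_rotation (c s : R) (G : R * R -> \bar R) :
  (c ^+ 2 + s ^+ 2 = 1)%R -> s != 0%R ->
  measurable_fun setT G -> (forall x, 0 <= G x) ->
  \int[leb]_x \int[leb]_y G (c * x - s * y, s * x + c * y)%R =
  \int[leb]_x \int[leb]_y G (x, y).
Proof.
move=> cs s0 mG G0.
(* The second argument of [h] is the first rotated coordinate: with [y' = c x - s y] one has
   [s x + c y = (x - c y') / s]. After the order of integration is exchanged, [x = s x' + c y]
   undoes the remaining shear. *)
pose h (z : R * R) := G (z.2, (z.1 - c * z.2) / s)%R.
have mh : measurable_fun setT h.
  apply: (measurableT_comp mG); apply: measurable_fun_pair => //=.
  apply: (measurable_funM (f := fun z : R * R => z.1 - c * z.2)%R) => //.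
  by apply: measurable_funB => //; exact: measurable_funM.
have mh1 x : measurable_fun setT (fun y => h (x, y)).
  exact: measurableT_comp.
have mh2 y : measurable_fun setT (fun x => h (x, y)).
  exact: measurableT_comp.
have F : \int[leb]_x \int[leb]_y h (x, y) = \int[leb]_y \int[leb]_x h (x, y).
  by apply: fubini_tonelli => // z; exact: G0.
have s1 : (0 < `|s|)%R by rewrite normr_gt0.
(* Both substitutions have Jacobian [|s|], so the identity is proved with this factor on each
   side. *)
suff E : `|s|%R%:E * \int[leb]_x \int[leb]_y G (c * x - s * y, s * x + c * y)%R =
    `|s|%R%:E * \int[leb]_x \int[leb]_y G (x, y).
  exact: pmule_inj E.
have mG1 x : measurable_fun setT (fun y => G (x, y)) by exact: measurableT_comp.
have mGr : measurable_fun setT (fun z : R * R => G (c * z.1 - s * z.2, s * z.1 + c * z.2)%R).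
  apply: (measurableT_comp mG); apply: measurable_fun_pair => //=.
  + by apply: measurable_funB; exact: measurable_funM.
  + by apply: measurable_funD; exact: measurable_funM.
have mI1 := @measurable_fun_fubini_tonelli_F _ _ _ _ _ leb _ mGr (fun z => G0 _).
have mI2 := @measurable_fun_fubini_tonelli_F _ _ _ _ _ leb _ mG G0.
rewrite -[LHS]ge0_integralZl; [|exact: measurableT|exact: mI1
  |by move=> x _; apply: integral_ge0 => y _; exact: G0|by rewrite lee_fin].
rewrite -[RHS]ge0_integralZl; [|exact: measurableT|exact: mI2
  |by move=> x _; apply: integral_ge0 => y _; exact: G0|by rewrite lee_fin].
transitivity (\int[leb]_x \int[leb]_y h (x, y)).
  apply: eq_integral => x _.
  have sN0 : (- s != 0)%R by rewrite oppr_eq0.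
  rewrite (ge0_integral_affine (c * x) sN0 (mh1 x) (fun y => G0 _)) normrN.
  congr (_ * _); apply: eq_integral => y _.
  have e1 : (c * x - s * y = - s * y + c * x)%R by ring.
  have e2 : (s * x + c * y = (x - c * (- s * y + c * x)) / s)%R.
    have s2 : (s ^+ 2 = 1 - c ^+ 2)%R by rewrite -cs; ring.
    transitivity ((s ^+ 2 * x + c * s * y) / s)%R; first by field.
    by rewrite s2; field.
  by rewrite /h/= -e2 e1.
rewrite F; apply: eq_integral => y _.
rewrite (ge0_integral_affine (c * y) s0 (mh2 y) (fun x => G0 _)).
congr (_ * _); apply: eq_integral => x _.
have e : ((s * x + c * y - c * y) / s = x)%R by field.
by rewrite /h/= e.
Qed.

End LebesgueAffine.

(** * Integration against the normal density *)

Section GaussDensity.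
Context {R : realType}.
Notation leb := (@lebesgue_measure R).
Notation gam := (@normal_prob R 0 1).
Notation pdf := (@normal_pdf R 0 1).
Local Open Scope ereal_scope.

Import HBNNSimple.

(** For indicators this is the definition of [normal_prob]; it passes to simple functions by
    linearity and to the limit by monotone convergence on both sides. *)
Lemma ge0_integral_normal (f : R -> \bar R) :
  measurable_fun setT f -> (forall x, 0 <= f x) ->
  \int[gam]_x f x = \int[leb]_x (f x * (pdf x)%:E).
Proof.
move=> mf f0.
have mp : measurable_fun setT (fun x => (pdf x)%:E).
  by apply/measurable_EFinP; exact: measurable_normal_pdf.
have p0 x : 0 <= (pdf x)%:E by rewrite lee_fin normal_pdf_ge0.
pose f_ := nnsfun_approx measurableT mf.
have nd (y : R) a b : (a <= b)%N -> (f_ a y <= f_ b y)%R.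
  by move=> ab; exact/lefP/nd_nnsfun_approx.
have mfn n : measurable_fun setT (fun x : R => (f_ n x)%:E) by exact/measurable_EFinP.
have mi0 n r : measurable_fun setT (fun x : R => \1_(f_ n @^-1` [set r]) x : R).
  by apply: measurable_indic; exact: measurable_sfunP.
have mi1 n r : measurable_fun setT (fun x : R => (\1_(f_ n @^-1` [set r]) x)%:E : \bar R).
  exact/measurable_EFinP.
have mi n r : measurable_fun setT (fun x : R => (r * \1_(f_ n @^-1` [set r]) x)%:E).
  by apply/measurable_EFinP; apply: measurable_funM.
transitivity (limn (fun n => \int[gam]_x (f_ n x)%:E)).
  rewrite -monotone_convergence//.
  - by apply: eq_integral => y _; apply/esym/cvg_lim => //; exact: cvg_nnsfun_approx.
  - by move=> n y _; rewrite lee_fin.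
  - by move=> y _ m n mn; rewrite lee_fin; exact: nd.
transitivity (limn (fun n => \int[leb]_x ((f_ n x)%:E * (pdf x)%:E))); last first.
  rewrite -monotone_convergence//.
  - apply: eq_integral => y _; apply/cvg_lim => //.
    by apply: cvgeZr => //; exact: cvg_nnsfun_approx.
  - by move=> n; apply: emeasurable_funM => //; exact: mfn.
  - by move=> n y _; apply: mule_ge0 => //; rewrite lee_fin.
  - move=> y _ m n mn; apply: lee_wpmul2r => //.
    by rewrite lee_fin; exact: nd.
congr (limn _); apply/funext => n.
under eq_integral do rewrite fimfunE -fsumEFin//.
rewrite ge0_integral_fsum//; last 2 first.
- exact: mi.
- by move=> r x _; rewrite nnfun_muleindic_ge0.
under [RHS]eq_integral.
  move=> x _; rewrite fimfunE -fsumEFin// ge0_mule_fsuml; last first.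
    by move=> r; rewrite nnfun_muleindic_ge0.
  over.
rewrite ge0_integral_fsum//; last 2 first.
- by move=> r; apply: emeasurable_funM => //; exact: mi.
- by move=> r x _; apply: mule_ge0 => //; rewrite nnfun_muleindic_ge0.
apply: eq_fsbigr => r _.
have [r0|r0] := leP 0%R r; last first.
  rewrite !integral0_eq// => x _; rewrite preimage_nnfun0// indicE in_set0 mulr0 ?mul0e//.
under eq_integral do rewrite EFinM.
under [RHS]eq_integral do rewrite EFinM -muleA.
rewrite !ge0_integralZl ?lee_fin//; last 3 first.
- by apply: emeasurable_funM => //; exact: mi1.
- by move=> x _; apply: mule_ge0 => //; rewrite lee_fin.
- exact: mi1.
congr (_ * _).
have mS : measurable (f_ n @^-1` [set r] : set R) by exact: measurable_sfunP.
rewrite integral_indic// setIT /normal_prob [LHS]integral_mkcond.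
apply: eq_integral => x _; rewrite patchE indicE; case: ifP => _; rewrite ?mul1e ?mul0e//.
Qed.

End GaussDensity.

(** * Rotation invariance of the planar Gaussian *)

Section GaussPlane.
Context {R : realType}.
Notation leb := (@lebesgue_measure R).
Notation gam := (@normal_prob R 0 1).
Notation pdf := (@normal_pdf R 0 1).
Local Open Scope ereal_scope.

Lemma normal_pdf01 (x : R) :
  pdf x = (normal_peak 1 * expR (- (x ^+ 2 / 2)))%R.
Proof.
by rewrite normal_pdfE ?oner_neq0// /normal_fun subr0 expr1n mulNr.
Qed.

Lemma normal_pdf_rotation (c s x y : R) : (c ^+ 2 + s ^+ 2 = 1)%R ->
  (pdf x * pdf y = pdf (c * x - s * y) * pdf (s * x + c * y))%R.
Proof.
move=> cs; rewrite 4!normal_pdf01 [LHS]mulrACA [RHS]mulrACA -2!expRD.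
congr (_ * expR _)%R; transitivity (- ((c ^+ 2 + s ^+ 2) * (x ^+ 2 + y ^+ 2)) / 2)%R.
  by rewrite cs; field.
by field.
Qed.

(** The joint density depends on [x^2 + y^2] alone, so once it is absorbed into the integrand the
    claim is [lebesgue_rotation]. *)
Lemma normal_rotation (c s : R) (F : R * R -> \bar R) :
  (c ^+ 2 + s ^+ 2 = 1)%R -> s != 0%R ->
  measurable_fun setT F -> (forall x, 0 <= F x) ->
  \int[gam \x gam]_z F (c * z.1 - s * z.2, s * z.1 + c * z.2)%R =
  \int[gam \x gam]_z F z.
Proof.
move=> cs s0 mF F0.
have mpdf : measurable_fun setT (fun x => (pdf x)%:E).
  by apply/measurable_EFinP; exact: measurable_normal_pdf.
have pdf0 x : 0 <= (pdf x)%:E by rewrite lee_fin normal_pdf_ge0.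
have prodE (G : R * R -> \bar R) : measurable_fun setT G -> (forall x, 0 <= G x) ->
    \int[gam \x gam]_z G z =
    \int[leb]_x \int[leb]_y (G (x, y) * ((pdf x)%:E * (pdf y)%:E)).
  move=> mG G0; rewrite fubini_tonelli1//.
  rewrite ge0_integral_normal; last 2 first.
  - exact: measurable_fun_fubini_tonelli_F.
  - by move=> x; exact: integral_ge0.
  apply: eq_integral => x _; rewrite /fubini_F ge0_integral_normal//; last first.
    exact: measurableT_comp.
  rewrite muleC -ge0_integralZl ?lee_fin ?normal_pdf_ge0//.
  - by apply: eq_integral => y _; rewrite muleCA.
  - by apply: emeasurable_funM => //; exact: measurableT_comp.
  - by move=> y _; exact: mule_ge0.
have mG : measurable_fun setT (fun z : R * R => F z * ((pdf z.1)%:E * (pdf z.2)%:E)).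
  apply: emeasurable_funM => //; apply: emeasurable_funM.
  - exact: (measurableT_comp mpdf).
  - exact: (measurableT_comp mpdf).
rewrite prodE//; last first.
  apply: (measurableT_comp mF); apply: measurable_fun_pair => //=.
  + by apply: measurable_funB; exact: measurable_funM.
  + by apply: measurable_funD; exact: measurable_funM.
rewrite [RHS]prodE; [|exact: mF|exact: F0].
have G0 z : 0 <= F z * ((pdf z.1)%:E * (pdf z.2)%:E).
  by apply: mule_ge0; [exact: F0|exact: mule_ge0].
apply: (etrans _ (lebesgue_rotation cs s0 mG G0)).
apply: eq_integral => x _; apply: eq_integral => y _ /=; congr (_ * _).
exact: (congr1 EFin (normal_pdf_rotation x y cs)).
Qed.

End GaussPlane.

(** * Second and fourth moments of the normal law *)

Section GaussMoments.
Context {R : realType}.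
Notation leb := (@lebesgue_measure R).
Notation gam := (@normal_prob R 0 1).
Notation pdf := (@normal_pdf R 0 1).
Local Open Scope ereal_scope.

Lemma normal_opp (f : R -> \bar R) :
  measurable_fun setT f -> (forall x, 0 <= f x) ->
  \int[gam]_x f (- x)%R = \int[gam]_x f x.
Proof.
move=> mf f0.
have mpdf : measurable_fun setT (fun x => (pdf x)%:E).
  by apply/measurable_EFinP; exact: measurable_normal_pdf.
rewrite !ge0_integral_normal//; last exact: measurableT_comp.
rewrite [RHS](@ge0_integral_affine _ (-1) 0)//; last 2 first.
- exact: emeasurable_funM.
- by move=> x; rewrite mule_ge0// lee_fin normal_pdf_ge0.
rewrite normrN normr1 mul1e; apply: eq_integral => x _.
have pN : pdf (- x) = pdf x by rewrite !normal_pdf01 sqrrN.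
by rewrite addr0 mulN1r pN.
Qed.

(** Half of the exponent pays for the polynomial: [x^4 <= 64 exp (x^2 / 4)], from
    [x^2 / 8 <= exp (x^2 / 8)]. What remains, [exp (- x^2 / 4)], is up to normalization the density
    of variance 2, whence [r = sqrt 2]. *)
Lemma normal_moment4_lty : \int[gam]_x (x ^+ 4)%:E < +oo.
Proof.
have m4 : measurable_fun setT (fun x : R => (x ^+ 4)%:E).
  by apply/measurable_EFinP; exact: exprn_measurable.
rewrite ge0_integral_normal//; last by move=> x; rewrite lee_fin exprn_even_ge0.
pose r := (Num.sqrt 2 : R).
pose K := (64 * normal_peak 1 / normal_peak r)%R.
have r0 : r != 0%R by rewrite sqrtr_eq0 -ltNge.
have pk : (0 < normal_peak r)%R by exact: normal_peak_gt0.
have K0 : (0 <= K)%R by rewrite /K !mulr_ge0 ?invr_ge0 ?normal_peak_ge0.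
have key (x : R) : (x ^+ 4 * pdf x <= K * normal_pdf 0 r x)%R.
  rewrite normal_pdf01 normal_pdfE// /normal_fun subr0.
  rewrite (_ : r ^+ 2 *+ 2 = 4)%R; last by rewrite sqr_sqrtr//; ring.
  rewrite [leRHS](_ : _ = (64 * expR (- x ^+ 2 / 4)) * normal_peak 1)%R; last first.
    by rewrite /K; field; rewrite gt_eqF.
  rewrite mulrCA [leRHS]mulrC ler_wpM2l ?normal_peak_ge0//.
  rewrite (_ : - (x ^+ 2 / 2) = - x ^+ 2 / 4 + - x ^+ 2 / 4)%R; last by field.
  rewrite expRD mulrA ler_wpM2r ?expR_ge0//.
  have h : (x ^+ 2 / 8 <= expR (x ^+ 2 / 8))%R.
    by apply: le_trans (expR_ge1Dx _); rewrite lerDr.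
  have h0 : (0 <= x ^+ 2 / 8)%R by rewrite mulr_ge0 ?sqr_ge0.
  have : ((x ^+ 2 / 8) ^+ 2 <= expR (x ^+ 2 / 8) ^+ 2)%R by rewrite ler_sqr ?nnegrE ?expR_ge0.
  rewrite -expRM_natr => h2.
  rewrite mulNr expRN ler_pdivrMr ?expR_gt0//.
  rewrite (_ : x ^+ 4 = 64 * (x ^+ 2 / 8) ^+ 2)%R; last by field.
  rewrite ler_wpM2l//; apply: (le_trans h2).
  by rewrite (_ : x ^+ 2 / 8 * 2 = x ^+ 2 / 4)%R//; field.
apply: (@le_lt_trans _ _ (\int[leb]_x (K%:E * (normal_pdf 0 r x)%:E))); last first.
  rewrite integralZl//; last exact: integrable_normal_pdf.
  by rewrite integral_normal_pdf mule1 ltry.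
apply: ge0_le_integral => //.
- by move=> x _; rewrite mule_ge0// lee_fin ?exprn_even_ge0 ?normal_pdf_ge0.
- apply: emeasurable_funM => //.
  by apply/measurable_EFinP; exact: measurable_normal_pdf.
- apply: emeasurable_funM => //.
  by apply/measurable_EFinP; exact: measurable_normal_pdf.
by move=> x _; exact: key.
Qed.

Let mX n : measurable_fun setT (fun x : R => (x ^+ n)%:E).
Proof. by apply/measurable_EFinP; exact: exprn_measurable. Qed.

Lemma normal_moment2_lty : \int[gam]_x (x ^+ 2)%:E < +oo.
Proof.
apply: (@le_lt_trans _ _ (\int[gam]_x (1 + (x ^+ 4)%:E))).
  apply: ge0_le_integral => //.
  - by move=> x _; rewrite lee_fin sqr_ge0.
  - exact: mX.
  - by apply: emeasurable_funD => //; exact: mX.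
  - move=> x _; rewrite -EFinD lee_fin.
    have : (0 <= (2^-1 - x ^+ 2) ^+ 2)%R by exact: sqr_ge0.
    by nra.
rewrite ge0_integralD//; [|by move=> x _; rewrite lee_fin exprn_even_ge0|exact: mX].
rewrite integral_cst// mul1e lte_add_pinfty ?normal_moment4_lty//.
by apply: (le_lt_trans (probability_le1 gam measurableT)); rewrite ltry.
Qed.

(** A zero integral would make [x^2] times the density vanish almost everywhere, while it is
    positive on []0, 1]], a set of measure 1. *)
Lemma normal_moment2_gt0 : 0 < \int[gam]_x (x ^+ 2)%:E.
Proof.
have I0 : 0 <= \int[gam]_x (x ^+ 2)%:E.
  by apply: integral_ge0 => x _; rewrite lee_fin sqr_ge0.
rewrite lt_neqAle I0 andbT; apply/negP => /eqP/esym E.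
have F0 (x : R) : (0 <= x ^+ 2 * normal_pdf 0 1 x)%R.
  by rewrite mulr_ge0 ?sqr_ge0 ?normal_pdf_ge0.
have mF : measurable_fun setT (fun x : R => (x ^+ 2 * normal_pdf 0 1 x)%:E).
  apply/measurable_EFinP; apply: measurable_funM => //.
  exact: measurable_normal_pdf.
have {E I0} E : \int[leb]_x `|(x ^+ 2 * normal_pdf 0 1 x)%:E| = 0.
  rewrite -[RHS]E ge0_integral_normal; [|exact: mX|by move=> x; rewrite lee_fin sqr_ge0].
  by apply: eq_integral => x _; rewrite gee0_abs; [rewrite EFinM|rewrite lee_fin; exact: F0].
have [N [mN N0 sN]] := (ae_eq_integral_abs leb measurableT mF).1 E.
have : leb `]0%R, 1%R] <= leb N.
  apply: le_measure; rewrite ?inE//; apply: subset_trans sN => x /=.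
  rewrite in_itv/= => /andP[x0 _]; move/(_ I) => -[].
  apply/eqP; rewrite mulf_eq0 negb_or expf_neq0 ?gt_eqF//=.
  by rewrite normal_pdf01 mulr_gt0 ?expR_gt0 ?normal_peak_gt0 ?oner_neq0.
by rewrite N0 lebesgue_measure_itv/= lte_fin ltr01 oppr0 adde0 lee_fin ler10.
Qed.

(* The rotation by [pi / 4] maps [x * y] to [(x ^+ 2 - y ^+ 2) / 2]. *)
Lemma normal_moment4E :
  \int[gam]_x (x ^+ 4)%:E = 3%:E * (\int[gam]_x (x ^+ 2)%:E * \int[gam]_x (x ^+ 2)%:E).
Proof.
pose r := ((Num.sqrt 2)^-1 : R)%R.
have r2 : (r ^+ 2 = 2^-1)%R by rewrite exprVn sqr_sqrtr.
have r0 : r != 0%R by rewrite invr_eq0 sqrtr_eq0 -ltNge.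
have rr : (r ^+ 2 + r ^+ 2 = 1)%R by rewrite r2; field.
pose F (z : R * R) := ((z.1 * z.2) ^+ 2)%:E.
pose G (z : R * R) := (((z.1 ^+ 2 - z.2 ^+ 2) / 2) ^+ 2)%:E.
have F0 z : 0 <= F z by rewrite lee_fin sqr_ge0.
have G0 z : 0 <= G z by rewrite lee_fin sqr_ge0.
have mF : measurable_fun setT F.
  by apply/measurable_EFinP; apply: measurable_funX; exact: measurable_funM.
have mG : measurable_fun setT G.
  apply/measurable_EFinP; apply: measurable_funX; apply: measurable_funM => //.
  by apply: measurable_funB; exact: measurable_funX.
have E : \int[gam \x gam]_z G z = \int[gam \x gam]_z F z.
  rewrite -(normal_rotation rr r0 mF F0); apply: eq_integral => z _.
  rewrite /G /F/=; congr (_ ^+ 2)%:E.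
  have -> : ((r * z.1 - r * z.2) * (r * z.1 + r * z.2) =
    r ^+ 2 * (z.1 ^+ 2 - z.2 ^+ 2))%R by ring.
  by rewrite r2 mulrC.
have := normal_moment2_lty; have := @normal_moment2_gt0.
set m2 := \int[gam]_x _; set m4 := \int[gam]_x _ => m2gt0 m2lty.
have m2fin : m2 \is a fin_num by rewrite ge0_fin_numE// ltW.
have m4fin : m4 \is a fin_num.
  rewrite ge0_fin_numE; first exact: normal_moment4_lty.
  by apply: integral_ge0 => x _; rewrite lee_fin exprn_even_ge0.
have EF : \int[gam \x gam]_z F z = m2 * m2.
  rewrite fubini_tonelli1//.
  transitivity (\int[gam]_x (m2 * (x ^+ 2)%:E)).
    apply: eq_integral => x _; rewrite /fubini_F /F/=.
    rewrite muleC -ge0_integralZl ?lee_fin ?sqr_ge0//.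
    - by apply: eq_integral => y _; rewrite -EFinM exprMn.
    - exact: mX.
    - by move=> y _; rewrite lee_fin sqr_ge0.
  rewrite ge0_integralZl//; [exact: mX| |exact: ltW].
  by move=> y _; rewrite lee_fin sqr_ge0.
have m1 : gam [set: R] = 1 by exact: probability_setT.
have cstE (a : \bar R) : \int[gam]_y a = a.
  by rewrite integral_cst// [X in _ * X]m1 mule1.
pose H1 (z : R * R) := (z.1 ^+ 4)%:E : \bar R.
pose H2 (z : R * R) := (z.2 ^+ 4)%:E : \bar R.
have mH1 : measurable_fun setT H1 by apply/measurable_EFinP; exact: measurable_funX.
have mH2 : measurable_fun setT H2 by apply/measurable_EFinP; exact: measurable_funX.
have H10 z : 0 <= H1 z by rewrite lee_fin exprn_even_ge0.
have H20 z : 0 <= H2 z by rewrite lee_fin exprn_even_ge0.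
have E1 : \int[gam \x gam]_z H1 z = m4.
  rewrite fubini_tonelli1//; apply: eq_integral => x _.
  exact: (cstE (x ^+ 4)%:E).
have E2 : \int[gam \x gam]_z H2 z = m4.
  rewrite fubini_tonelli2//; apply: eq_integral => x _.
  exact: (cstE (x ^+ 4)%:E).
(* Pointwise, [(x^2 - y^2)^2 + 2 x^2 y^2 = x^4 + y^4]. As [G] and [F] have the same integral, this
   gives six times the squared second moment on the left and twice the fourth moment on the right.
   The form as a sum avoids subtracting extended reals. *)
have : \int[gam \x gam]_z (4%:E * G z) + \int[gam \x gam]_z (2%:E * F z) = m4 + m4.
  rewrite -{1}E1 -E2 -!ge0_integralD//; last 4 first.
  - by move=> x _; rewrite mule_ge0.
  - exact: emeasurable_funM.
  - by move=> x _; rewrite mule_ge0.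
  - exact: emeasurable_funM.
  apply: eq_integral => z _; rewrite /G /F /H1 /H2 -!EFinM -!EFinD; congr EFin.
  by field.
rewrite !ge0_integralZl// E EF -(fineK m2fin) -(fineK m4fin) -!EFinM -!EFinD => -[] ?.
by congr EFin; lra.
Qed.

End GaussMoments.

(** * Independent standard Gaussian families *)

Section Configurations.
Context {R : realType} {I : finType}.

Definition box (B : I -> set R) : set (I -> R) := [set x | forall i, B i (x i)].

Definition boxes : set (set (I -> R)) :=
  [set A | exists2 B, (forall i, measurable (B i)) & A = box B].

(** The product sigma-algebra on [I -> R]. Its generators are closed under intersection, so a
    probability on it is determined by its values on boxes. *)
Definition cfg := g_sigma_algebraType boxes.

Lemma setI_closed_boxes : setI_closed boxes.
Proof.
move=> _ _ [B mB ->] [C mC ->]; exists (fun i => B i `&` C i).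
  by move=> i; exact: measurableI.
apply/seteqP; split => x /=.
  by move=> [xB xC] i; split; [exact: xB|exact: xC].
by move=> xBC; split => i; case: (xBC i).
Qed.

Lemma boxes_setT : boxes setT.
Proof. by exists (fun=> setT) => //; apply/seteqP; split. Qed.

Lemma measurable_box (B : I -> set R) : (forall i, measurable (B i)) ->
  measurable (box B : set cfg).
Proof. by move=> mB; apply: sub_sigma_algebra; exists B. Qed.

Lemma measurable_coord i : measurable_fun setT (fun x : cfg => x i).
Proof.
move=> _ C mC; rewrite setTI.
rewrite (_ : _ @^-1` _ = box (fun j => if j == i then C else setT)).
  by apply: measurable_box => j; case: ifP.
apply/seteqP; split => x /=; last by move=> /(_ i); rewrite eqxx.
by move=> xC j; case: eqP => // ->.
Qed.

Lemma preimage_box (T : Type) (X : T -> I -> R) B :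
  X @^-1` box B = \bigcap_(i in [set: I]) ((fun w => X w i) @^-1` B i).
Proof.
by apply/seteqP; split => w /=; [move=> h i _; exact: h|move=> h i; exact: h].
Qed.

Lemma measurable_cfg d (T : measurableType d) (X : T -> cfg) :
  (forall i, measurable_fun setT (fun w => X w i)) -> measurable_fun setT X.
Proof.
move=> mX; apply: (@measurability _ _ T cfg setT X boxes erefl) => _ [_ [B mB ->] <-].
rewrite setTI preimage_box; apply: fin_bigcap_measurable => [|i _].
  exact: finite_finset.
by rewrite -[X in measurable X]setTI; exact: mX.
Qed.

End Configurations.
Arguments cfg : clear implicits.

(** * Laws with independent standard normal coordinates *)

Section GaussLaw.
Context {R : realType}.
Notation gam := (@normal_prob R 0 1).
Local Open Scope ereal_scope.

(** Independence and the marginals in one condition. It speaks of plain functions rather than of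
    bundled random variables, so that [X] can be reindexed, spliced and rotated freely. *)
Definition gauss_law d (T : measurableType d) (P : probability T R)
    (I : finType) (X : T -> I -> R) :=
  (forall i, measurable_fun setT (fun w => X w i)) /\
  forall B, (forall i, measurable (B i)) ->
    P (X @^-1` box B) = \prod_(i : I) gam (B i).

(** The two pushforwards on [cfg R I] agree on boxes, which are stable under intersection and
    generate the sigma-algebra. *)
Lemma gauss_law_eq d (T : measurableType d) (P : probability T R)
    d' (T' : measurableType d') (P' : probability T' R) (I : finType)
    (X : T -> I -> R) (X' : T' -> I -> R) (A : set (cfg R I)) :
  gauss_law P X -> gauss_law P' X' -> measurable A ->
  P (X @^-1` A) = P' (X' @^-1` A).
Proof.
move=> [mX PX] [mX' PX'] mA.
pose m := push_measure P (measurable_cfg mX : measurable_fun setT (X : T -> cfg R I)).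
pose m' := push_measure P' (measurable_cfg mX' : measurable_fun setT (X' : T' -> cfg R I)).
have cov : \bigcup_(k : nat) (setT : set (cfg R I)) = setT.
  by apply/seteqP; split => // x _; exists 0%N.
apply: (@measure_unique _ R (cfg R I) boxes (fun=> setT) erefl
  setI_closed_boxes (fun=> boxes_setT) cov m m') => //.
- by move=> _ [B mB ->]; rewrite /m /m' /push_measure/= /pushforward PX// PX'.
- by move=> _; apply: (le_lt_trans (probability_le1 P measurableT)); rewrite ltry.
Qed.

Lemma gauss_law_integral d (T : measurableType d) (P : probability T R)
    d' (T' : measurableType d') (P' : probability T' R) (I : finType)
    (X : T -> I -> R) (X' : T' -> I -> R) (f : cfg R I -> \bar R) :
  gauss_law P X -> gauss_law P' X' ->
  measurable_fun setT f -> (forall x, 0 <= f x) ->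
  \int[P]_w f (X w) = \int[P']_w f (X' w).
Proof.
move=> gX gX' mf f0.
have mX : measurable_fun setT (X : T -> cfg R I) by apply: measurable_cfg; exact: gX.1.
have mX' : measurable_fun setT (X' : T' -> cfg R I) by apply: measurable_cfg; exact: gX'.1.
transitivity (\int[push_measure P mX]_x f x).
  by rewrite /push_measure/= ge0_integral_pushforward.
transitivity (\int[push_measure P' mX']_x f x).
  by apply: eq_measure_integral => A mA _; exact: gauss_law_eq.
by rewrite /push_measure/= ge0_integral_pushforward.
Qed.

Lemma gauss_law_ext d (T : measurableType d) (P : probability T R)
    (I : finType) (X Y : T -> I -> R) :
  (forall w i, X w i = Y w i) -> gauss_law P X -> gauss_law P Y.
Proof. by move=> XY; have -> : X = Y by apply/funext => w; apply/funext => i. Qed.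

Lemma gauss_law_reindex d (T : measurableType d) (P : probability T R)
    (I J : finType) (f : J -> I) (X : T -> I -> R) :
  injective f -> gauss_law P X -> gauss_law P (fun w j => X w (f j)).
Proof.
move=> fI [mX PX]; split => [j|B mB]; first exact: mX.
(* Coordinates outside the image of [f] are left unconstrained and contribute factors 1. *)
pose B' i := if [pick j | f j == i] is Some j then B j else setT.
have B'f j : B' (f j) = B j.
  rewrite /B'; case: pickP => [j' /eqP/fI ->//|/(_ j)]; by rewrite eqxx.
rewrite (_ : _ @^-1` _ = X @^-1` box B'); last first.
  apply/seteqP; split => w /= h; last by move=> j; rewrite -B'f; exact: h.
  move=> i; rewrite /B'; case: pickP => // j /eqP <-; exact: h.
rewrite PX; last by move=> i; rewrite /B'; case: pickP.
have E : \prod_(i | i \notin [set f j | j : J]%SET) gam (B' i) = 1.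
  apply: big1 => i /imsetP fi; rewrite /B'; case: pickP => [j /eqP fj|_].
    by exfalso; apply: fi; exists j.
  exact: probability_setT.
rewrite (bigID (fun i => i \in [set f j | j : J]%SET))/= E mule1.
rewrite big_imset/=; last by move=> ? ? _ _; exact: fI.
by apply: eq_big => [j|j _]; rewrite ?inE// B'f.
Qed.

(** The substitute for conditioning: part of the coordinates is redrawn from an independent copy
    without changing the law, after which each part lives on its own factor of the product space. *)
Lemma gauss_law_mix d (T : measurableType d) (P : probability T R)
    d' (T' : measurableType d') (P' : probability T' R) (I : finType)
    (D : pred I) (X : T -> I -> R) (X' : T' -> I -> R) :
  gauss_law P X -> gauss_law P' X' ->
  gauss_law (P \x P') (fun z i => if D i then X z.1 i else X' z.2 i).
Proof.
move=> [mX PX] [mX' PX']; split => [i|B mB].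
  case: (D i).
  - exact: (measurableT_comp (mX i)).
  - exact: (measurableT_comp (mX' i)).
pose B1 i := if D i then B i else setT; pose B2 i := if D i then setT else B i.
have mB1 i : measurable (B1 i) by rewrite /B1; case: ifP.
have mB2 i : measurable (B2 i) by rewrite /B2; case: ifP.
have mXB (e : measure_display) (U : measurableType e) (Y : U -> I -> R) C :
    (forall i, measurable_fun setT (fun w => Y w i)) ->
    (forall i, measurable (C i)) -> measurable (Y @^-1` box C).
  move=> mY mC; rewrite -[X in measurable X]setTI.
  by apply: (measurable_cfg mY) => //; exact: measurable_box.
rewrite (_ : _ @^-1` _ = (X @^-1` box B1) `*` (X' @^-1` box B2)); last first.
  apply/seteqP; split => -[w w'] /=.
    by move=> h; split => i /=; have := h i; rewrite /B1 /B2; case: (D i).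
  by move=> [h1 h2] i /=; have := h1 i; have := h2 i; rewrite /B1 /B2; case: (D i).
apply: (etrans (product_measure1E P P' (mXB _ _ _ _ mX mB1) (mXB _ _ _ _ mX' mB2))).
apply: (etrans (congr2 (@mule R) (PX _ mB1) (PX' _ mB2))).
rewrite -big_split; apply: eq_bigr => i _ /=; rewrite /B1 /B2.
have g1 : gam setT = 1 by exact: probability_setT.
by case: (D i); rewrite g1 ?mule1 ?mul1e.
Qed.

Lemma normal_prob_opp (B : set R) : measurable B -> gam (-%R @^-1` B) = gam B.
Proof.
move=> mB; have mf : measurable_fun setT (fun x : R => (\1_B x)%:E : \bar R).
  by apply/measurable_EFinP; exact: measurable_indic.
have mNB : measurable (-%R @^-1` B : set R).
  by rewrite -[X in measurable X]setTI; exact: oppr_measurable.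
have h0 (x : R) : 0 <= (\1_B x)%:E :> \bar R by rewrite lee_fin.
have := normal_opp mf h0; rewrite [X in _ = X -> _]integral_indic// setIT => <-.
by rewrite -[X in gam X]setIT -integral_indic.
Qed.

Lemma gauss_law_opp d (T : measurableType d) (P : probability T R)
    (I : finType) (D : pred I) (X : T -> I -> R) :
  gauss_law P X -> gauss_law P (fun w i => if D i then (- X w i)%R else X w i).
Proof.
move=> [mX PX]; split => [i|B mB].
  by case: (D i); [exact: measurable_funN|exact: mX].
pose B' i := if D i then -%R @^-1` B i else B i.
rewrite (_ : _ @^-1` _ = X @^-1` box B'); last first.
  apply/seteqP; split => w /= h i; have := h i; rewrite /B'; by case: (D i).
rewrite PX.
  by apply: eq_bigr => i _; rewrite /B'; case: (D i) => //; exact: normal_prob_opp.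
move=> i; rewrite /B'; case: (D i) => //.
by rewrite -[X in measurable X]setTI; exact: oppr_measurable.
Qed.

End GaussLaw.

(** * Rotation of two coordinates of a Gaussian family *)

Section GaussRotation.
Context {R : realType}.
Notation gam := (@normal_prob R 0 1).
Local Open Scope ereal_scope.

Lemma normal_rotation_rect (c s : R) (B1 B2 : set R) :
  (c ^+ 2 + s ^+ 2 = 1)%R -> s != 0%R -> measurable B1 -> measurable B2 ->
  (gam \x gam) [set z | B1 (c * z.1 - s * z.2)%R /\ B2 (s * z.1 + c * z.2)%R] =
  gam B1 * gam B2.
Proof.
move=> cs s0 mB1 mB2.
have mB : measurable (B1 `*` B2) by exact: measurableX.
pose F (z : R * R) := (\1_(B1 `*` B2) z)%:E : \bar R.
have mF : measurable_fun setT F by apply/measurable_EFinP; exact: measurable_indic.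
have F0 z : 0 <= F z by rewrite lee_fin.
have := normal_rotation cs s0 mF F0.
rewrite [X in _ = X -> _]integral_indic// setIT.
move=> E; pose mu : probability (measurableTypeR R) R := gam.
apply: (etrans _ (etrans E (product_measure1E mu mu mB1 mB2))).
have mr : measurable_fun setT (fun z : R * R => (c * z.1 - s * z.2, s * z.1 + c * z.2)%R).
  apply: measurable_fun_pair => //=.
  + by apply: measurable_funB; exact: measurable_funM.
  + by apply: measurable_funD; exact: measurable_funM.
have mS : measurable [set z : R * R | B1 (c * z.1 - s * z.2)%R /\ B2 (s * z.1 + c * z.2)%R].
  by have := mr measurableT _ mB; rewrite setTI.
by rewrite -[X in _ X = _]setIT -integral_indic.
Qed.

Definition rotate_coord (I : finType) (i j : I) (c s : R) (x : I -> R) (l : I) : R :=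
  if l == i then (c * x i - s * x j)%R else
  if l == j then (s * x i + c * x j)%R else x l.

Lemma measurable_rotate_coord (I : finType) (i j : I) (c s : R) :
  measurable_fun setT (rotate_coord i j c s : cfg R I -> cfg R I).
Proof.
apply: measurable_cfg => l; rewrite /rotate_coord; case: (l == i); last case: (l == j).
- by apply: measurable_funB; apply: measurable_funM => //; exact: measurable_coord.
- by apply: measurable_funD; apply: measurable_funM => //; exact: measurable_coord.
- exact: measurable_coord.
Qed.

(** The rotated preimage of a box is not a box. Hence [X] is replaced by [Z], of the same law, whose
    coordinates [i] and [j] form a normal pair on a separate factor; for [Z] the preimage is a box
    ([B0], free in [i] and [j]) times a planar event, and [normal_rotation_rect] evaluates the
    latter. *)
Lemma gauss_law_rotate d (T : measurableType d) (P : probability T R)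
    (I : finType) (i j : I) (c s : R) (X : T -> I -> R) :
  i != j -> (c ^+ 2 + s ^+ 2 = 1)%R -> s != 0%R ->
  gauss_law P X -> gauss_law P (fun w => rotate_coord i j c s (X w)).
Proof.
move=> ij cs s0 gX; have [mX PX] := gX.
pose mu : probability (measurableTypeR R) R := gam.
pose Q : probability _ R := (mu \x mu)%E.
pose Z (z : T * (R * R)) (l : I) : R :=
  if l == i then z.2.1 else if l == j then z.2.2 else X z.1 l.
pose B0 (B : I -> set R) (l : I) := if (l == i) || (l == j) then setT else B l.
have mB0 B : (forall l, measurable (B l)) -> forall l, measurable (B0 B l).
  by move=> mB l; rewrite /B0; case: ifP.
have mXB B : (forall l, measurable (B l)) -> measurable (X @^-1` box B).
  move=> mB; rewrite -[X in measurable X]setTI.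
  by apply: (measurable_cfg mX) => //; exact: measurable_box.
have prodB B : (forall l, measurable (B l)) ->
    \prod_(l : I) gam (B l) = P (X @^-1` box (B0 B)) * (gam (B i) * gam (B j)).
  move=> mB; rewrite (PX _ (mB0 _ mB)) (bigD1 i)//= (bigD1 j)/=; last by rewrite eq_sym.
  rewrite [in RHS](bigD1 i)//= [in RHS](bigD1 j)/=; last by rewrite eq_sym.
  have g1 : gam setT = 1 by exact: probability_setT.
  rewrite /B0 !eqxx orbT/= g1 !mul1e muleA muleC; congr (_ * _).
  by apply: eq_bigr => l /andP[/negPf-> /negPf->].
have gZ : gauss_law (P \x Q) Z.
  split => [l|B mB].
    rewrite /Z; case: (l == i); last case: (l == j).
    - exact: (measurableT_comp measurable_fst measurable_snd).
    - exact: (measurableT_comp measurable_snd measurable_snd).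
    - exact: (measurableT_comp (mX l) measurable_fst).
  rewrite (_ : _ @^-1` _ = (X @^-1` box (B0 B)) `*` (B i `*` B j)); last first.
    apply/seteqP; split => -[w [x y]] /=.
      move=> h; split => /=.
        by move=> l; have := h l; rewrite /B0 /Z/=; case: ifP => //=; case: ifP.
      split; first by have := h i; rewrite /Z eqxx.
      by have := h j; rewrite /Z eqxx eq_sym (negPf ij).
    move=> [h1 [/= hx hy]] l; rewrite /Z/=; case: ifPn => [/eqP->//|li].
    case: ifPn => [/eqP->//|lj].
    by have := h1 l; rewrite /B0/= (negPf li) (negPf lj).
  apply: (etrans (product_measure1E P Q (mXB _ (mB0 _ mB)) (measurableX (mB i) (mB j)))).
  rewrite prodB//; congr (_ * _).
  exact: (product_measure1E mu mu (mB i) (mB j)).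
split => [l|B mB].
  exact: (measurableT_comp (measurable_coord l)
    (measurableT_comp (measurable_rotate_coord i j c s) (measurable_cfg mX))).
have mA : measurable (rotate_coord i j c s @^-1` box B : set (cfg R I)).
  rewrite -[X in measurable X]setTI.
  by apply: measurable_rotate_coord => //; exact: measurable_box.
apply: (etrans (gauss_law_eq gX gZ mA)).
pose E := [set z : R * R | B i (c * z.1 - s * z.2)%R /\ B j (s * z.1 + c * z.2)%R].
have mE : measurable E.
  have mr : measurable_fun setT (fun z : R * R => (c * z.1 - s * z.2, s * z.1 + c * z.2)%R).
    apply: measurable_fun_pair => //=.
    + by apply: measurable_funB; exact: measurable_funM.
    + by apply: measurable_funD; exact: measurable_funM.
  by have := mr measurableT _ (measurableX (mB i) (mB j)); rewrite setTI.
rewrite (_ : Z @^-1` _ = (X @^-1` box (B0 B)) `*` E); last first.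
  apply/seteqP; split => -[w [x y]] /=.
    move=> h; split => /=.
      move=> l; have := h l; rewrite /B0 /rotate_coord /Z/=.
      by case: (l == i) => //=; case: (l == j).
    split.
      by have := h i; rewrite /rotate_coord /Z !eqxx eq_sym (negPf ij).
    by have := h j; rewrite /rotate_coord /Z !eqxx eq_sym (negPf ij).
  move=> [h1 [/= hx hy]] l; rewrite /rotate_coord /Z/= !eqxx (eq_sym j) (negPf ij).
  case: ifPn => [/eqP->//|li]; case: ifPn => [/eqP->//|lj].
  by have := h1 l; rewrite /B0/= (negPf li) (negPf lj).
apply: (etrans (product_measure1E P Q (mXB _ (mB0 _ mB)) mE)).
by rewrite prodB//; congr (_ * _); exact: normal_rotation_rect.
Qed.

End GaussRotation.

(** * Orthogonal invariance and diagonalization *)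

Section OrthogonalInvariance.
Context {R : realType}.

Definition gauss_matrix d (T : measurableType d) (P : probability T R) k m
    (X : T -> 'M[R]_(k, m)) :=
  gauss_law P (fun w (p : 'I_k * 'I_m) => X w p.1 p.2).

(** Row [l] is the rotated [l]-th basis vector, so that right multiplication rotates the coordinates
    [a] and [b] of every row. *)
Definition givens m (a b : 'I_m) (c s : R) : 'M[R]_m :=
  \matrix_(l, l') rotate_coord a b c s (fun q => (q == l)%:R) l'.

Lemma mulmx_givens k m (a b : 'I_m) (c s : R) (X : 'M[R]_(k, m)) i l :
  (X *m givens a b c s) i l = rotate_coord a b c s (X i) l.
Proof.
have S (q : 'I_m) : \sum_p X i p * (q == p)%:R = X i q.
  rewrite (bigD1 q)//= eqxx mulr1 big1 ?addr0// => p pq.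
  by rewrite eq_sym (negPf pq) mulr0.
rewrite mxE; under eq_bigr do rewrite mxE.
rewrite /rotate_coord; case: (l == a); last case: (l == b) => //.
- under eq_bigr do rewrite mulrBr mulrCA (mulrCA _ s).
  by rewrite sumrB -!mulr_sumr !S.
- under eq_bigr do rewrite mulrDr mulrCA (mulrCA _ c).
  by rewrite big_split/= -!mulr_sumr !S.
Qed.

Lemma trmx_givens m (a b : 'I_m) (c s : R) : a != b ->
  (givens a b c s)^T = givens a b c (- s).
Proof.
move=> ab; have ba := ab; rewrite eq_sym in ba.
apply/matrixP => l l'; rewrite !mxE /rotate_coord.
rewrite !(eq_sym a) !(eq_sym b) (eq_sym l l').
have [->|la] := eqVneq l a; have [->|l'a] := eqVneq l' a;
  rewrite ?eqxx ?(negPf ab) ?(negPf ba) ?(negPf la) ?(negPf l'a) //=.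
- by ring.
- by case: (l' == b) => /=; ring.
- by rewrite (eq_sym a) (negPf la); case: (l == b) => /=; ring.
- have [lE|lb] := eqVneq l b; have [l'E|l'b] := eqVneq l' b => //=.
  + by ring.
  + by rewrite lE (negPf l'b)/=; ring.
  + by rewrite l'E eq_sym (negPf lb)/=; ring.
Qed.

Lemma givens_orthogonal m (a b : 'I_m) (c s : R) :
  a != b -> c ^+ 2 + s ^+ 2 = 1 -> givens a b c s *m (givens a b c s)^T = 1%:M.
Proof.
move=> ab cs; have ba := ab; rewrite eq_sym in ba.
rewrite trmx_givens//; apply/matrixP => i l; rewrite mulmx_givens.
rewrite /rotate_coord !mxE /rotate_coord !eqxx ?(negPf ba).
rewrite (eq_sym i).
have [->|la] := eqVneq l a.
  transitivity ((c ^+ 2 + s ^+ 2) * (a == i)%:R); last by rewrite cs mul1r.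
  by ring.
have [->|lb] := eqVneq l b => //.
transitivity ((c ^+ 2 + s ^+ 2) * (b == i)%:R); last by rewrite cs mul1r.
by ring.
Qed.

(** [gauss_law_rotate] acts on one pair of entries, that is, on one row; the induction is on the
    list [r] of the rows already rotated. *)
Lemma gauss_matrix_givens d (T : measurableType d) (P : probability T R) k m
    (X : T -> 'M[R]_(k, m)) (a b : 'I_m) (c s : R) :
  a != b -> c ^+ 2 + s ^+ 2 = 1 -> s != 0 ->
  gauss_matrix P X -> gauss_matrix P (fun w => X w *m givens a b c s).
Proof.
move=> ab cs s0 gX.
suff H (r : seq 'I_k) : uniq r -> gauss_law P (fun w (p : 'I_k * 'I_m) =>
    if p.1 \in r then (X w *m givens a b c s) p.1 p.2 else X w p.1 p.2).
  apply: gauss_law_ext (H (enum 'I_k) (enum_uniq _)) => w p.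
  by rewrite mem_enum.
elim: r => [_|i r IH /= /andP[ir ur]]; first exact: gX.
have abi : (i, a) != (i, b) by apply/eqP => -[] /eqP; rewrite (negPf ab).
apply: gauss_law_ext (gauss_law_rotate abi cs s0 (IH ur)) => w [j l] /=.
rewrite {1}/rotate_coord !xpair_eqE/= inE (negPf ir).
have [->|ji] := eqVneq j i => //=.
by rewrite (negPf ir) mulmx_givens /rotate_coord.
Qed.

(** The quantification over spaces, row numbers and [X] lets one matrix serve for the sketch and for
    its independent version with one row less, and makes the property stable under products. *)
Definition gauss_invariant m (Q : 'M[R]_m) :=
  forall d (T : measurableType d) (P : probability T R) k (X : T -> 'M[R]_(k, m)),
    gauss_matrix P X -> gauss_matrix P (fun w => X w *m Q).

(* Givens rotations kill the nonzero entries of [u] one at a time; a diagonal sign matrix finishes. *)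
Lemma gauss_invariant_to_delta m (u : 'cV[R]_m.+1) : u^T *m u = 1%:M ->
  exists Q, [/\ Q *m Q^T = 1%:M, gauss_invariant Q & Q *m u = delta_mx 0 0].
Proof.
have [n] := ubnP #|[pred l : 'I_m.+1 | (l != 0) && (u l 0 != 0)]|.
elim: n u => // n IH u un u1.
have [[l /andP[l0 ul0]]|u0] := pselect (exists l : 'I_m.+1, (l != 0) && (u l 0 != 0)).
  pose r : R := Num.sqrt (u 0 0 ^+ 2 + u l 0 ^+ 2).
  have r2 : r ^+ 2 = u 0 0 ^+ 2 + u l 0 ^+ 2 by rewrite sqr_sqrtr// addr_ge0 ?sqr_ge0.
  have r0 : r != 0.
    by rewrite gt_eqF// sqrtr_gt0 ltr_wpDl ?sqr_ge0// exprn_even_gt0.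
  pose c := u 0 0 / r; pose s := u l 0 / r.
  have cs : c ^+ 2 + s ^+ 2 = 1.
    by rewrite /c /s !expr_div_n -mulrDl -r2 divff// expf_neq0.
  have s0 : s != 0 by rewrite mulf_neq0 ?invr_eq0.
  have l0' : 0 != l by rewrite eq_sym.
  pose G := givens 0 l c s.
  have GG := givens_orthogonal l0' cs.
  have Gu q : (G *m u) q 0 = rotate_coord 0 l c (- s) (fun q => u q 0) q.
    have -> : (G *m u) q 0 = (u^T *m G^T) 0 q by rewrite -trmx_mul [RHS]mxE.
    rewrite trmx_givens// mulmx_givens.
    by rewrite /rotate_coord !mxE.
  have Gl : (G *m u) l 0 = 0.
    rewrite Gu /rotate_coord (negPf l0) eqxx /s /c; field.
    exact: r0.
  have [||Q [QQ Qinv Qu]] := IH (G *m u).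
  (* The rotation changes the entries 0 and [l] and kills the latter, so the set of nonzero entries
     outside position 0 loses [l] and gains nothing. *)
  - rewrite ltnS in un; apply: leq_trans un.
    apply: proper_card; apply/properP; split.
      apply/fintype.subsetP => q; rewrite !inE => /andP[q0]; rewrite q0 /=.
      have [->|ql] := eqVneq q l; first by rewrite Gl eqxx.
      by rewrite Gu /rotate_coord (negPf q0) (negPf ql).
    by exists l; rewrite !inE ?l0 ?ul0// Gl eqxx.
  - rewrite trmx_mul -mulmxA (mulmxA _ G).
    by rewrite (mulmx1C GG) mul1mx.
  exists (Q *m G); split; last by rewrite -mulmxA.
  - by rewrite trmx_mul mulmxA -(mulmxA Q) GG mulmx1.
  - move=> d T P k X gX.
    have := gauss_matrix_givens l0' cs s0 (Qinv _ _ _ _ _ gX).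
    by apply: gauss_law_ext => w p; rewrite mulmxA.
have ul l : l != 0 -> u l 0 = 0.
  by move=> l0; apply/eqP; apply: contrapT => /negP ul; apply: u0; exists l; rewrite l0 ul.
have u0sq : u 0 0 ^+ 2 = 1.
  have /matrixP/(_ 0 0) := u1; rewrite !mxE eqxx (bigD1 0)//= big1 ?addr0 ?mxE.
    by rewrite expr2.
  by move=> l l0; rewrite ul// mulr0.
pose Q : 'M[R]_m.+1 := diag_mx (\row_l if l == 0 then u 0 0 else 1).
have XQ k (X : 'M[R]_(k, m.+1)) i l : (X *m Q) i l = X i l * if l == 0 then u 0 0 else 1.
  by rewrite mul_mx_diag !mxE.
exists Q; split.
- apply/matrixP => i l; rewrite tr_diag_mx XQ !mxE.
  have [->|il] := eqVneq i l; last by rewrite !mulr0n mul0r.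
  by rewrite mulr1n; case: (l == 0); rewrite ?mulr1// -expr2.
- move=> d T P k X gX.
  move/eqP: u0sq; rewrite sqrf_eq1 => /orP[]/eqP u00.
    by apply: gauss_law_ext gX => w p; rewrite XQ u00 if_same mulr1.
  apply: gauss_law_ext (gauss_law_opp (fun p => p.2 == 0) gX) => w p /=.
  by rewrite XQ u00; case: ifP; rewrite ?mulrN1 ?mulr1.
- apply/matrixP => i j; rewrite mul_diag_mx !mxE ord1 eqxx andbT.
  by have [->|i0] := eqVneq i 0; [rewrite -expr2|rewrite ul// mulr0].
Qed.

End OrthogonalInvariance.

(** * Diagonalization of real symmetric matrices *)

Section Spectral.
Context {R : realType}.

(* A complex eigenvalue [a] with row eigenvector [v] is real because [v v^* != 0]. *)
Lemma symmetric_eigenvalue n (M : 'M[R]_n.+1) : M^T = M -> exists a, eigenvalue M a.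
Proof.
move=> MT; pose f := real_complex R; pose MC := map_mx f M.
have [a /[dup] aE /eigenvalueP[v va v0]] := @eigenvalue_closed R[i] n.+1 MC isT.
pose w := map_mx (@conjc R) v.
have cf (x : R) : conjc (f x) = f x by rewrite /conjc /f /= oppr0.
have wa : w *m MC = conjc a *: w.
  rewrite -map_mxZ -va map_mxM; congr (_ *m _).
  by apply/matrixP => i j; rewrite !mxE; exact/esym/cf.
have MCT : MC^T = MC by rewrite /MC map_trmx MT.
have E : a *: (v *m w^T) = conjc a *: (v *m w^T).
  rewrite scalemxAl -va -mulmxA -[in LHS]MCT -trmx_mul wa.
  by rewrite linearZ/= -scalemxAr.
have vw : (v *m w^T) 0 0 != 0.
  rewrite mxE psumr_neq0.
    case/rV0Pn: v0 => j vj; apply/hasP; exists j; first by rewrite mem_index_enum.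
    by rewrite !mxE/= mul_conjC_gt0.
  by move=> j _; rewrite !mxE mul_conjC_ge0.
have aR : a = conjc a.
  by move/matrixP/(_ 0 0): E; rewrite !mxE => /(mulIf _); apply; move: vw; rewrite mxE.
have [r ar] : exists r, a = f r.
  case: (a) aR => x y [] yN; exists x; rewrite /f.
  by have -> : y = 0 by lra.
exists r; rewrite eigenvalue_root_char.
have : root (map_poly f (char_poly M)) (f r).
  by rewrite map_char_poly -ar -eigenvalue_root_char.
by rewrite fmorph_root.
Qed.

Lemma symmetric_unit_eigenvector n (M : 'M[R]_n.+1) : M^T = M ->
  exists a (v : 'cV[R]_n.+1), v^T *m v = 1%:M /\ M *m v = a *: v.
Proof.
move=> MT; have [a /eigenvalueP[v va v0]] := symmetric_eigenvalue MT.
pose s := \sum_j v 0 j ^+ 2.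
have s0 : 0 < s.
  rewrite lt_def sumr_ge0 ?andbT => [|j _]; last exact: sqr_ge0.
  rewrite psumr_neq0 => [|j _]; last exact: sqr_ge0.
  case/rV0Pn: v0 => j vj; apply/hasP; exists j; first by rewrite mem_index_enum.
  by rewrite /= exprn_even_gt0.
exists a, ((Num.sqrt s)^-1 *: v^T); split.
  rewrite [(_ *: v^T)^T]linearZ/= trmxK -scalemxAl -scalemxAr scalerA.
  rewrite -invfM -expr2 sqr_sqrtr ?ltW//.
  apply/matrixP => i j; rewrite !ord1 !mxE eqxx.
  under eq_bigr do rewrite mxE -expr2.
  by rewrite mulVf ?gt_eqF.
rewrite -scalemxAr scalerA mulrC -scalerA; congr (_ *: _).
by rewrite -[M]MT -trmx_mul va linearZ.
Qed.

(** Deflation: an orthogonal [Q] carries a unit eigenvector to the first basis vector, so the first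
    column of [Q M Q^T] is a multiple of that vector. By symmetry the first row is too, and the
    induction applies to the remaining block. *)
Lemma symmetric_diagonalization n (M : 'M[R]_n) : M^T = M ->
  exists (V : 'M[R]_n) (d : 'rV[R]_n), V^T *m V = 1%:M /\ M = V *m diag_mx d *m V^T.
Proof.
elim: n M => [|n IH] M MT.
  by exists 0, 0; split; apply/matrixP => -[].
have [a [v [v1 Mv]]] := symmetric_unit_eigenvector MT.
have [Q [QQ _ Qv]] := gauss_invariant_to_delta v1.
have QTQ : Q^T *m Q = 1%:M := mulmx1C QQ.
pose N : 'M[R]_(1 + n) := Q *m M *m Q^T.
have NT : N^T = N by rewrite /N !trmx_mul trmxK MT mulmxA.
have Qe : Q^T *m delta_mx 0 0 = v by rewrite -Qv mulmxA QTQ mul1mx.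
have N0 : Q *m M *m Q^T *m delta_mx 0 0 = a *: (delta_mx 0 0 : 'cV[R]_n.+1).
  by rewrite -mulmxA Qe -mulmxA Mv -scalemxAr Qv.
have NE i : N i 0 = a *+ (i == 0).
  have := congr1 (fun X : 'cV[R]_n.+1 => X i 0) N0; rewrite /= [RHS]mxE [X in _ = _ * X -> _]mxE.
  rewrite eqxx andbT mulr_natr => <-.
  rewrite [RHS]mxE (bigD1 0)//= big1 ?addr0; first by rewrite [X in _ * X]mxE mulr1.
  by move=> j j0; rewrite [X in _ * X]mxE (negPf j0) mulr0.
have NQ : N = Q *m M *m Q^T by [].
clearbody N; pose N' : 'M[R]_n := drsubmx N.
have N'T : N'^T = N' by rewrite /N' -{2}NT trmx_drsub.
have [V [d [VV N'E]]] := IH N' N'T.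
have Nblock : N = block_mx a%:M 0 0 N'.
  rewrite -[LHS]submxK; congr block_mx.
  - apply/matrixP => i j; rewrite !ord1 !mxE eqxx mulr1n.
    have -> : lshift n (0 : 'I_1) = 0 by apply: val_inj.
    by rewrite NE eqxx.
  - apply/matrixP => i j; rewrite !mxE -NT mxE !ord1.
    have -> : lshift n (0 : 'I_1) = 0 by apply: val_inj.
    by rewrite NE.
  - apply/matrixP => i j; rewrite !mxE !ord1.
    have -> : lshift n (0 : 'I_1) = 0 by apply: val_inj.
    by rewrite NE.
pose W : 'M[R]_(1 + n) := block_mx 1%:M 0 0 V.
have WW : W^T *m W = 1%:M.
  rewrite /W tr_block_mx !trmx0 trmx1 mulmx_block.
  by rewrite !mulmx0 !mul0mx !addr0 !add0r mul1mx VV -scalar_mx_block.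
have key : N = W *m (diag_mx (row_mx (a%:M : 'M[R]_1) d) *m W^T).
  rewrite Nblock N'E /W diag_mx_row tr_block_mx !trmx0 trmx1 !mulmx_block.
  rewrite !mulmx0 !mul0mx !addr0 !add0r !mul1mx !mulmx0 !mulmx1 mulmxA.
  by congr block_mx; apply/matrixP => i j; rewrite !ord1 !mxE.
exists (Q^T *m W), (row_mx a%:M d); split.
  by rewrite trmx_mul trmxK mulmxA -(mulmxA _ Q) QQ mulmx1 WW.
have -> : M = Q^T *m N *m Q.
  by rewrite NQ !mulmxA QTQ mul1mx -mulmxA QTQ mulmx1.
rewrite trmx_mul trmxK !mulmxA; congr (_ *m _); rewrite -!mulmxA; congr (_ *m _).
exact: key.
Qed.

End Spectral.

(** * Ridge projectors *)

Section RidgeProjector.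
Context {R : realType}.
Implicit Types t : R.

Definition sqn n (v : 'cV[R]_n) : R := \sum_i v i 0 ^+ 2.

Definition quad n (N : 'M[R]_n) (v : 'cV[R]_n) : R := (v^T *m N *m v) 0 0.

Definition gram k n (X : 'M[R]_(k, n)) (t : R) : 'M[R]_k := X *m X^T + t%:M.

Definition rproj k n (X : 'M[R]_(k, n)) (t : R) : 'M[R]_n :=
  X^T *m invmx (gram X t) *m X.

Lemma sqn_ge0 n (v : 'cV[R]_n) : 0 <= sqn v.
Proof. by apply: sumr_ge0 => i _; rewrite sqr_ge0. Qed.

Lemma sqn_eq0 n (v : 'cV[R]_n) : sqn v = 0 -> v = 0.
Proof.
move=> /eqP; rewrite psumr_eq0 => [/allP v0|i _]; last exact: sqr_ge0.
apply/colP => i; rewrite mxE; apply/eqP.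
by have := v0 i (mem_index_enum _); rewrite sqrf_eq0.
Qed.

Lemma sqnE n (v : 'cV[R]_n) : (v^T *m v) 0 0 = sqn v.
Proof. by rewrite mxE; apply: eq_bigr => i _; rewrite mxE expr2. Qed.

Lemma unit_vectorE m (u : 'cV[R]_m) : sqn u = 1 -> u^T *m u = 1%:M.
Proof. by move=> u1; apply/matrixP => i j; rewrite !ord1 sqnE u1 mxE. Qed.

Lemma sqnB n (u v : 'cV[R]_n) :
  sqn (u - v) = sqn u - (u^T *m v) 0 0 *+ 2 + sqn v.
Proof.
rewrite mxE /sqn -sumrMnl -sumrB -big_split; apply: eq_bigr => i _ /=.
by rewrite !mxE; ring.
Qed.

Lemma sqnD n (u v : 'cV[R]_n) :
  sqn (u + v) = sqn u + (u^T *m v) 0 0 *+ 2 + sqn v.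
Proof.
rewrite mxE /sqn -sumrMnl -!big_split; apply: eq_bigr => i _ /=.
by rewrite !mxE; ring.
Qed.

Lemma quadD n (M N : 'M[R]_n) v : quad (M + N) v = quad M v + quad N v.
Proof. by rewrite /quad mulmxDr mulmxDl mxE. Qed.

Lemma quadB n (M N : 'M[R]_n) v : quad (M - N) v = quad M v - quad N v.
Proof. by rewrite /quad mulmxBr mulmxBl !mxE. Qed.

Lemma quad_scalar n a (v : 'cV[R]_n) : quad a%:M v = a * sqn v.
Proof. by rewrite /quad mul_mx_scalar -scalemxAl mxE sqnE. Qed.

Lemma quad1 n (v : 'cV[R]_n) : quad 1%:M v = sqn v.
Proof. by rewrite quad_scalar mul1r. Qed.

Lemma quad_gram k n (X : 'M[R]_(k, n)) t v : quad (gram X t) v = sqn (X^T *m v) + t * sqn v.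
Proof.
by rewrite quadD quad_scalar -[sqn (X^T *m v)]sqnE /quad trmx_mul trmxK !mulmxA.
Qed.

(** The Gram matrix is positive definite whatever the rank of [X], its quadratic form being
    [|X^T v|^2 + t |v|^2]. *)
Lemma gram_unit k n (X : 'M[R]_(k, n)) t : 0 < t -> gram X t \in unitmx.
Proof.
move=> t0; rewrite -row_free_unit; apply: inj_row_free => v vK.
have : quad (gram X t) v^T = 0 by rewrite /quad trmxK vK mul0mx mxE.
rewrite quad_gram => /eqP; rewrite paddr_eq0 ?sqn_ge0 ?mulr_ge0 ?sqn_ge0 ?ltW//.
rewrite mulf_eq0 (gt_eqF t0) /= => /andP[_ /eqP/sqn_eq0/(congr1 trmx)].
by rewrite trmxK trmx0.
Qed.

Lemma tr_gram k n (X : 'M[R]_(k, n)) t : (gram X t)^T = gram X t.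
Proof. by rewrite /gram linearD/= tr_scalar_mx trmx_mul trmxK. Qed.

Lemma tr_invgram k n (X : 'M[R]_(k, n)) t : (invmx (gram X t))^T = invmx (gram X t).
Proof. by rewrite trmx_inv tr_gram. Qed.

Lemma tr_rproj k n (X : 'M[R]_(k, n)) t : (rproj X t)^T = rproj X t.
Proof. by rewrite /rproj !trmx_mul trmxK tr_invgram mulmxA. Qed.

Lemma quad_invgram_ge0 k n (X : 'M[R]_(k, n)) t v : 0 < t ->
  0 <= quad (invmx (gram X t)) v.
Proof.
move=> t0; have Ku := gram_unit X t0.
have -> : quad (invmx (gram X t)) v = quad (gram X t) (invmx (gram X t) *m v).
  by rewrite /quad trmx_mul tr_invgram !mulmxA mulmxKV.
by rewrite quad_gram addr_ge0 ?mulr_ge0 ?sqn_ge0// ltW.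
Qed.

Lemma quad_rproj k n (X : 'M[R]_(k, n)) t v :
  quad (rproj X t) v = quad (invmx (gram X t)) (X *m v).
Proof. by rewrite /quad /rproj trmx_mul !mulmxA. Qed.

Lemma quad_rproj_ge0 k n (X : 'M[R]_(k, n)) t v : 0 < t -> 0 <= quad (rproj X t) v.
Proof. by move=> t0; rewrite quad_rproj quad_invgram_ge0. Qed.

(* [r] minimizes the penalized residual on the right-hand side (ridge regression of [v] on the rows
   of [X]). *)
Lemma quad_rprojC k n (X : 'M[R]_(k, n)) t v : 0 < t ->
  let r := invmx (gram X t) *m (X *m v) in
  quad (1%:M - rproj X t) v = sqn (v - X^T *m r) + t * sqn r.
Proof.
move=> t0 r; have Ku := gram_unit X t0.
have Kr : gram X t *m r = X *m v by rewrite /r mulKVmx.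
have E : quad (gram X t) r = (v^T *m X^T *m r) 0 0.
  by rewrite /quad -mulmxA Kr /r !trmx_mul tr_invgram !mulmxA.
have E' : quad (rproj X t) v = (v^T *m X^T *m r) 0 0.
  by rewrite quad_rproj /quad trmx_mul -!mulmxA.
rewrite quadB quad1 E' sqnB mulmxA -addrA -quad_gram E; ring.
Qed.

Lemma quad_rprojC_ge0 k n (X : 'M[R]_(k, n)) t v : 0 < t ->
  0 <= quad (1%:M - rproj X t) v.
Proof. by move=> t0; rewrite quad_rprojC// addr_ge0 ?mulr_ge0 ?sqn_ge0// ltW. Qed.

(** In operator form, [t K^-1 <= 1]. For [w = K r] the difference of the two sides is
    [|X X^T r|^2 + t |X^T r|^2]. *)
Lemma quad_invgram_le k n (X : 'M[R]_(k, n)) t w : 0 < t ->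
  t * quad (invmx (gram X t)) w <= sqn w.
Proof.
move=> t0; have [r ->] : exists r, w = gram X t *m r.
  by exists (invmx (gram X t) *m w); rewrite mulKVmx// gram_unit.
have -> : quad (invmx (gram X t)) (gram X t *m r) = quad (gram X t) r.
  by rewrite /quad trmx_mul tr_gram !mulmxA mulmxK// gram_unit.
have -> : gram X t *m r = X *m (X^T *m r) + t *: r.
  by rewrite /gram mulmxDl mul_scalar_mx mulmxA.
have E : ((X *m (X^T *m r))^T *m (t *: r)) 0 0 = t * sqn (X^T *m r).
  by rewrite -scalemxAr mxE trmx_mul -mulmxA sqnE.
have Z : sqn (t *: r) = t ^+ 2 * sqn r.
  by rewrite /sqn mulr_sumr; apply: eq_bigr => i _; rewrite mxE exprMn.
rewrite sqnD E Z quad_gram -subr_ge0.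
have -> : sqn (X *m (X^T *m r)) + t * sqn (X^T *m r) *+ 2 + t ^+ 2 * sqn r -
    t * (sqn (X^T *m r) + t * sqn r) = sqn (X *m (X^T *m r)) + t * sqn (X^T *m r) by ring.
by rewrite addr_ge0 ?mulr_ge0 ?sqn_ge0// ltW.
Qed.

(** With [Y] the pseudoinverse, [X X^T Y^T = X], hence [K Y^T = X + t Y^T]. Multiplying by [K^-1]
    and substituting twice gives [Y X - P_t = t (Y Y^T - t Y K^-1 Y^T)]. The bracket lies between 0
    (by [quad_invgram_le]) and [Y Y^T]. *)
Lemma pinv_rproj k n (X : 'M[R]_(k, n)) t v : 0 < t ->
  0 <= quad (Defs.pinv X *m X) v - quad (rproj X t) v <= t * sqn ((Defs.pinv X)^T *m v).
Proof.
move=> t0; have [XYX YXY XYT YXT] := pinvP X; set Y := Defs.pinv X in XYX YXY XYT YXT *.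
set K := gram X t; have Ku : K \in unitmx := gram_unit X t0.
have KT : (invmx K)^T = invmx K := tr_invgram X t.
have XXY : X *m X^T *m Y^T = X.
  by rewrite -mulmxA -trmx_mul YXT mulmxA XYX.
have KY : K *m Y^T = X + t *: Y^T by rewrite /K /gram mulmxDl XXY mul_scalar_mx.
have YE : Y^T = invmx K *m X + t *: (invmx K *m Y^T).
  by rewrite scalemxAr -mulmxDr -KY mulKmx.
have PE : Y *m X = rproj X t + t *: (X^T *m invmx K *m Y^T).
  rewrite -YXT trmx_mul {1}YE mulmxDr /rproj -/K -scalemxAr !mulmxA //.
have XKE : X^T *m invmx K = Y - t *: (Y *m invmx K).
  have := congr1 trmx YE; rewrite trmxK linearD/= linearZ/= !trmx_mul KT trmxK => {1}->.
  by rewrite addrK.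
pose w := Y^T *m v.
have dE : quad (Y *m X) v - quad (rproj X t) v = t * (sqn w - t * quad (invmx K) w).
  rewrite {1}PE quadD addrAC subrr add0r /quad -scalemxAr -scalemxAl mxE; congr (_ * _).
  rewrite XKE mulmxBl mulmxBr mulmxBl mxE; congr (_ + _).
    by rewrite -sqnE /w trmx_mul trmxK !mulmxA.
  rewrite -scalemxAl -scalemxAr -scalemxAl [LHS]mxE [X in - X = _]mxE.
  by rewrite /w trmx_mul trmxK !mulmxA.
have iK0 : 0 <= quad (invmx K) w by exact: quad_invgram_ge0.
rewrite dE; apply/andP; split; last first.
  by rewrite ler_pM2l// lerBlDr lerDl mulr_ge0// ltW.
rewrite pmulr_rge0//.
by rewrite subr_ge0 quad_invgram_le.
Qed.

End RidgeProjector.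

(** * Rank-one updates and the trace of the inverse Gram matrix *)

Section RidgeBounds.
Context {R : realType}.
Implicit Types t : R.

Lemma addmxE m n (A B : 'M[R]_(m, n)) i j : (A + B) i j = A i j + B i j.
Proof. by rewrite mxE. Qed.

Lemma oppmxE m n (A : 'M[R]_(m, n)) i j : (- A) i j = - A i j.
Proof. by rewrite mxE. Qed.

Lemma scalemxE m n a (A : 'M[R]_(m, n)) i j : (a *: A) i j = a * A i j.
Proof. by rewrite mxE. Qed.

Lemma quad_delta n (N : 'M[R]_n) i : quad N (delta_mx i 0) = N i i.
Proof.
by rewrite /quad trmx_delta -rowE -colE !mxE.
Qed.

(** By cyclicity the trace equals [k - t tr K^-1]. *)
Lemma mxtrace_rproj_le k n (X : 'M[R]_(k, n)) t : 0 < t -> \tr (rproj X t) <= k%:R.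
Proof.
move=> t0; have Ku := gram_unit X t0.
rewrite /rproj mxtrace_mulC mulmxA.
have -> : X *m X^T = gram X t - t%:M by rewrite /gram addrK.
rewrite mulmxBl mulmxV// mul_scalar_mx linearB/= mxtrace1 linearZ/= lerBlDr lerDl.
apply: mulr_ge0; first exact: ltW.
rewrite /mxtrace; apply: sumr_ge0 => i _.
by rewrite -quad_delta quad_invgram_ge0.
Qed.

(** Projecting [X^T a] orthogonally to [v] shortens it. This supplies the comparison that
    [mxtrace_invgram_ge] asks for. *)
Lemma sqn_complement k n (X : 'M[R]_(k, n)) (v : 'cV[R]_n) a : sqn v = 1 ->
  sqn ((X *m (1%:M - v *m v^T))^T *m a) <= sqn (X^T *m a).
Proof.
move=> v1.
have vv := unit_vectorE v1.
have -> : (X *m (1%:M - v *m v^T))^T *m a = X^T *m a - v *m (v^T *m (X^T *m a)).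
  by rewrite trmx_mul linearB/= trmx1 trmx_mul trmxK -mulmxA mulmxBl mul1mx mulmxA.
move: (X^T *m a) => s.
have sv : (s^T *m (v *m (v^T *m s))) 0 0 = sqn (v^T *m s).
  by rewrite -sqnE trmx_mul trmxK mulmxA.
have vs : sqn (v *m (v^T *m s)) = sqn (v^T *m s).
  by rewrite -[LHS]sqnE trmx_mul -mulmxA (mulmxA v^T) vv mul1mx sqnE.
rewrite sqnB sv vs; have := sqn_ge0 (v^T *m s); set x := sqn _ => x0.
by rewrite mulr2n; lra.
Qed.

(** Sherman-Morrison: with [g = X v] and [W] the Gram matrix of the part orthogonal to [v],
    [K = W + g g^T], so [K W^-1 g = (1 + y) g]. *)
Lemma quad_rproj_rank1 k n (X : 'M[R]_(k, n)) (v : 'cV[R]_n) t : 0 < t -> sqn v = 1 ->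
  let y := quad (invmx (gram (X *m (1%:M - v *m v^T)) t)) (X *m v) in
  quad (rproj X t) v = y / (1 + y).
Proof.
move=> t0 v1; set Y := X *m _ => y.
have vv := unit_vectorE v1.
have Wu := gram_unit Y t0; have Ku := gram_unit X t0.
set g := X *m v in y *.
have KE : gram X t = gram Y t + g *m g^T.
  rewrite /gram addrAC; congr (_ + _).
  have NT : (1%:M - v *m v^T)^T = 1%:M - v *m v^T.
    by rewrite linearB/= trmx1 trmx_mul trmxK.
  have NN : (1%:M - v *m v^T) *m (1%:M - v *m v^T) = 1%:M - v *m v^T.
    rewrite mulmxBr mulmx1 mulmxBl mul1mx mulmxA -(mulmxA v) vv mulmx1.
    by rewrite subrr subr0.
  rewrite /Y /g (trmx_mul X (1%:M - _)) NT (trmx_mul X v) !mulmxA -(mulmxA X) NN.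
  by rewrite -(mulmxA X v) -mulmxDl -mulmxDr subrK mulmx1.
pose r := invmx (gram Y t) *m g.
have gr : (g^T *m r) = y%:M.
  by rewrite /r mulmxA; apply/matrixP => i j; rewrite !ord1 [RHS]mxE.
have y0 : 0 <= y by exact: quad_invgram_ge0.
have Kr : gram X t *m r = (1 + y) *: g.
  rewrite KE mulmxDl /r mulKVmx// -/r -mulmxA gr mul_mx_scalar.
  by rewrite scalerDl scale1r.
have y1 : 1 + y != 0 by rewrite gt_eqF// ltr_pwDl.
have E : invmx (gram X t) *m g = (1 + y)^-1 *: r.
  by rewrite -[r](mulKmx Ku) Kr -scalemxAr scalerA mulVf// scale1r.
rewrite quad_rproj -/g /quad -mulmxA E -scalemxAr mxE gr mxE eqxx mulr1n.
by rewrite mulrC.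
Qed.

(* Completing the square in [W^-1 (e_l - b W a)]. *)
Lemma invgram_diag_ge k n (Y : 'M[R]_(k, n)) t (b : R) (a : 'cV[R]_k) l : 0 < t ->
  2 * b * a l 0 - b ^+ 2 * quad (gram Y t) a <= invmx (gram Y t) l l.
Proof.
move=> t0; have Wu := gram_unit Y t0.
set W := gram Y t in Wu *; pose e : 'cV[R]_k := delta_mx l 0.
have WT : (invmx W)^T = invmx W := tr_invgram Y t.
have := @quad_invgram_ge0 _ _ _ Y t (e - b *: (W *m a)) t0; rewrite -/W.
have ea : (e^T *m a) 0 0 = a l 0.
  by rewrite /e trmx_delta -rowE mxE.
have ae : (a^T *m e) 0 0 = a l 0.
  by rewrite -[a^T *m e]trmxK mxE trmx_mul trmxK ea.
have -> : quad (invmx W) (e - b *: (W *m a)) =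
    invmx W l l - 2 * b * a l 0 + b ^+ 2 * quad W a.
  have eT : (e - b *: (W *m a))^T = e^T - b *: (a^T *m W).
    by rewrite linearB/= [(b *: _)^T]linearZ/= (trmx_mul W a) (tr_gram Y t).
  rewrite /quad eT.
  have -> : (e^T - b *: (a^T *m W)) *m invmx W = e^T *m invmx W - b *: a^T.
    by rewrite mulmxBl -scalemxAl mulmxK.
  have WK : e^T *m invmx W *m (W *m a) = e^T *m a by rewrite mulmxA mulmxKV.
  rewrite mulmxBr !mulmxBl -!scalemxAr -!scalemxAl WK.
  rewrite !(addmxE, oppmxE, scalemxE) ea ae -/(quad (invmx W) e) quad_delta mulmxA.
  by ring.
by lra.
Qed.

(** Take 1 at position [l] and minus the ridge coefficients elsewhere, so that [X^T a] is the
    residual of row [l]. The extra [t] is the penalty on the entry 1. *)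
Lemma gram_row_removal k n (X : 'M[R]_(k.+1, n)) t l : 0 < t ->
  exists a : 'cV[R]_k.+1, a l 0 = 1 /\
    quad (gram X t) a = t + quad (1%:M - rproj (row' l X) t) (row l X)^T.
Proof.
move=> t0; pose r := invmx (gram (row' l X) t) *m (row' l X *m (row l X)^T).
pose a : 'cV[R]_k.+1 := \col_i if unlift l i is Some j then - r j 0 else 1.
have al : a l 0 = 1 by rewrite mxE unlift_none.
have aj j : a (lift l j) 0 = - r j 0 by rewrite mxE liftK.
exists a; split => //.
rewrite quad_gram quad_rprojC// -/r.
have -> : X^T *m a = (row l X)^T - (row' l X)^T *m r.
  apply/colP => i; rewrite !mxE (bigD1_ord l)//= al mxE mulr1; congr (_ + _).
  by rewrite -sumrN; apply: eq_bigr => j _; rewrite aj !mxE mulrN.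
have -> : sqn a = 1 + sqn r.
  rewrite /sqn (bigD1_ord l)//= al expr1n; congr (_ + _).
  by apply: eq_bigr => j _; rewrite aj sqrrN.
by ring.
Qed.

(* The diagonal of [(X X^T + t)^-1] is bounded below by the reciprocals of the ridge residuals of
   the rows; the AM-HM inequality then bounds its trace. *)
Lemma mxtrace_invgram_ge k n (X Y : 'M[R]_(k.+1, n)) t : 0 < t ->
  (forall a, sqn (Y^T *m a) <= sqn (X^T *m a)) ->
  k.+1%:R ^+ 2 <= (\sum_l (t + quad (1%:M - rproj (row' l X) t) (row l X)^T)) *
    \tr (invmx (gram Y t)).
Proof.
move=> t0 YX; set Q := \sum_l _.
have Q0 : 0 < Q.
  rewrite /Q big_ord_recl ltr_pwDl//; first by rewrite ltr_pwDl// quad_rprojC_ge0.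
  by apply: sumr_ge0 => l _; rewrite addr_ge0 ?quad_rprojC_ge0 ?ltW.
(* The maximizer of [2 b (k + 1) - b^2 Q], the sum over [l] of the bounds of [invgram_diag_ge] with
   a common [b]. The vectors come from [X]; the comparison hypothesis makes their [gram Y] form no
   larger than their [gram X] form. *)
pose b := k.+1%:R / Q.
have : 2 * b * k.+1%:R - b ^+ 2 * Q <= \tr (invmx (gram Y t)).
  have -> : 2 * b * k.+1%:R = \sum_(l < k.+1) 2 * b by rewrite sumr_const card_ord mulr_natr.
  rewrite /Q mulr_sumr -sumrB; apply: ler_sum => l _.
  have [a [al aE]] := gram_row_removal X l t0.
  apply: le_trans (invgram_diag_ge Y b a l t0); rewrite al mulr1 lerB//.
  by rewrite ler_wpM2l ?sqr_ge0// -aE !quad_gram lerD2r.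
have -> : 2 * b * k.+1%:R - b ^+ 2 * Q = k.+1%:R ^+ 2 / Q.
  by rewrite /b; field; rewrite gt_eqF.
by rewrite ler_pdivrMr// mulrC.
Qed.

End RidgeBounds.

(** * Gaussian quadratic forms *)

Section MatrixMeasurability.
Context {R : realType} d (T : measurableType d).

Definition mx_measurable m n (X : T -> 'M[R]_(m, n)) :=
  forall i j, measurable_fun setT (fun w => X w i j).

Lemma mx_measurable_cst m n (A : 'M[R]_(m, n)) : mx_measurable (fun=> A).
Proof. by move=> i j; exact: measurable_cst. Qed.

Lemma mx_measurable_matrix m n (F : T -> 'I_m -> 'I_n -> R) :
  (forall i j, measurable_fun setT (fun w => F w i j)) ->
  mx_measurable (fun w => \matrix_(i, j) F w i j).
Proof.
move=> mF i j; rewrite (_ : (fun w => _) = (fun w => F w i j)); first exact: mF.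
by apply/funext => w; rewrite mxE.
Qed.

Lemma mx_measurableD m n (X Y : T -> 'M[R]_(m, n)) :
  mx_measurable X -> mx_measurable Y -> mx_measurable (fun w => X w + Y w).
Proof.
move=> mX mY i j; under eq_fun do rewrite mxE.
exact: measurable_funD.
Qed.

Lemma mx_measurableM m n p (X : T -> 'M[R]_(m, n)) (Y : T -> 'M[R]_(n, p)) :
  mx_measurable X -> mx_measurable Y -> mx_measurable (fun w => X w *m Y w).
Proof.
move=> mX mY i j; under eq_fun do rewrite mxE.
by apply: measurable_sum => l; exact: measurable_funM.
Qed.

Lemma mx_measurable_tr m n (X : T -> 'M[R]_(m, n)) :
  mx_measurable X -> mx_measurable (fun w => (X w)^T).
Proof. by move=> mX i j; under eq_fun do rewrite mxE; exact: mX. Qed.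

Lemma mx_measurable_row m n (X : T -> 'M[R]_(m, n)) l :
  mx_measurable X -> mx_measurable (fun w => row l (X w)).
Proof. by move=> mX i j; under eq_fun do rewrite mxE; exact: mX. Qed.

Lemma mx_measurable_row' m n (X : T -> 'M[R]_(m, n)) l :
  mx_measurable X -> mx_measurable (fun w => row' l (X w)).
Proof. by move=> mX i j; under eq_fun do rewrite mxE; exact: mX. Qed.

Lemma mx_measurable_mulr k m n (X : T -> 'M[R]_(k, m))
    (A : 'M[R]_(m, n)) :
  mx_measurable X -> mx_measurable (fun w => X w *m A).
Proof. by move=> mX; apply: mx_measurableM => //; exact: mx_measurable_cst. Qed.

Lemma measurable_det n (X : T -> 'M[R]_n) :
  mx_measurable X -> measurable_fun setT (fun w => \det (X w)).
Proof.
move=> mX; apply: measurable_sum => s; apply: measurable_funM => //.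
by apply: measurable_prod => i _; exact: mX.
Qed.

(** [1 / f = f * (1 / f^2)], and [1 / x = exp (- ln x)] for positive [x]; the square disposes of the
    sign of [f]. *)
Lemma measurable_inv (f : T -> R) : (forall w, f w != 0) ->
  measurable_fun setT f -> measurable_fun setT (fun w => (f w)^-1).
Proof.
move=> f0 mf.
have -> : (fun w => (f w)^-1) = (fun w => f w * expR (- ln (f w ^+ 2))).
  apply/funext => w; rewrite expRN lnK; first by field.
  by rewrite posrE exprn_even_gt0 ?f0 ?orbT.
apply: measurable_funM => //; apply: measurableT_comp => //.
apply: measurableT_comp => //; apply: measurableT_comp; first exact: measurable_ln.
exact: measurable_funX.
Qed.

Lemma mx_measurable_inv n (X : T -> 'M[R]_n) : (forall w, X w \in unitmx) ->
  mx_measurable X -> mx_measurable (fun w => invmx (X w)).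
Proof.
move=> uX mX i j; under eq_fun do rewrite /invmx uX !mxE.
apply: measurable_funM.
  apply: measurable_inv; last exact: measurable_det.
  by move=> w; rewrite -unitfE -unitmxE.
under eq_fun do rewrite /cofactor.
apply: measurable_funM => //.
by apply: measurable_det => a b; under eq_fun do rewrite !mxE; exact: mX.
Qed.

Lemma measurable_quad n (N : T -> 'M[R]_n) (v : T -> 'cV[R]_n) :
  mx_measurable N -> mx_measurable v -> measurable_fun setT (fun w => quad (N w) (v w)).
Proof.
move=> mN mv; apply: mx_measurableM => //; apply: mx_measurableM => //.
exact: mx_measurable_tr.
Qed.

Lemma measurable_mxtrace n (N : T -> 'M[R]_n) :
  mx_measurable N -> measurable_fun setT (fun w => \tr (N w)).
Proof. by move=> mN; apply: measurable_sum => i; exact: mN. Qed.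

Lemma mx_measurable_gram k n (X : T -> 'M[R]_(k, n)) (t : R) :
  mx_measurable X -> mx_measurable (fun w => gram (X w) t).
Proof.
move=> mX; apply: mx_measurableD; last exact: mx_measurable_cst.
by apply: mx_measurableM => //; exact: mx_measurable_tr.
Qed.

Lemma mx_measurable_rproj k n (X : T -> 'M[R]_(k, n)) (t : R) : 0 < t ->
  mx_measurable X -> mx_measurable (fun w => rproj (X w) t).
Proof.
move=> t0 mX; apply: mx_measurableM => //; apply: mx_measurableM.
  exact: mx_measurable_tr.
apply: mx_measurable_inv; last exact: mx_measurable_gram.
by move=> w; exact: gram_unit.
Qed.

End MatrixMeasurability.

Section GaussianMatrices.
Context {R : realType}.

Definition mx_of_cfg k m (x : cfg R ('I_k * 'I_m)%type) : 'M[R]_(k, m) :=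
  \matrix_(i, j) x (i, j).

Lemma mx_measurable_mx_of_cfg k m : mx_measurable (@mx_of_cfg k m).
Proof. by apply: mx_measurable_matrix => i j; exact: measurable_coord. Qed.

Lemma gauss_matrix_integral d (T : measurableType d) (P : probability T R)
    d' (T' : measurableType d') (P' : probability T' R) k m
    (X : T -> 'M[R]_(k, m)) (X' : T' -> 'M[R]_(k, m)) (F : 'M[R]_(k, m) -> \bar R) :
  gauss_matrix P X -> gauss_matrix P' X' ->
  measurable_fun setT (fun x => F (mx_of_cfg x)) -> (forall M, 0 <= F M)%E ->
  (\int[P]_w F (X w) = \int[P']_w F (X' w))%E.
Proof.
move=> gX gX' mF F0; have := gauss_law_integral gX gX' mF (fun=> F0 _).
have K (M : 'M[R]_(k, m)) : mx_of_cfg (fun p => M p.1 p.2) = M.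
  by apply/matrixP => i j; rewrite mxE.
by under eq_integral do rewrite K; under [X in _ = X -> _]eq_integral do rewrite K.
Qed.

Lemma gauss_matrix_measurable d (T : measurableType d) (P : probability T R) k m
    (X : T -> 'M[R]_(k, m)) : gauss_matrix P X -> mx_measurable X.
Proof. by move=> [mX _] i j; exact: (mX (i, j)). Qed.

End GaussianMatrices.


(** * Mean and second moment of a Gaussian quadratic form *)

Section GaussianForms.
Context {R : realType}.
Notation gam := (@normal_prob R 0 1).

(* This is 1, but only its positivity matters: it cancels in the final bound. *)
Definition moment2 : R := fine (\int[gam]_x (x ^+ 2)%:E)%E.

Lemma moment2E : (\int[gam]_x (x ^+ 2)%:E = moment2%:E)%E.
Proof.
rewrite fineK// ge0_fin_numE ?normal_moment2_lty//.
by apply: integral_ge0 => x _; rewrite lee_fin sqr_ge0.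
Qed.

Lemma moment2_gt0 : 0 < moment2.
Proof. by rewrite -lte_fin -moment2E normal_moment2_gt0. Qed.

Lemma moment4E : (\int[gam]_x (x ^+ 4)%:E = (3 * moment2 ^+ 2)%:E)%E.
Proof. by rewrite normal_moment4E moment2E -!EFinM -expr2. Qed.

Context d (T : measurableType d) (P : probability T R) (k : nat).
Context (g : T -> 'cV[R]_k) (gg : gauss_law P (fun w i => g w i 0)).

(** A law-preserving [Q] with [Q v] the first basis vector turns [v^T g] into the first coordinate
    of [g]. *)
Lemma gauss_unit_integral (v : 'cV[R]_k) (f : R -> \bar R) : sqn v = 1 ->
  measurable_fun setT f -> (forall x, 0 <= f x)%E ->
  (\int[P]_w f ((v^T *m g w) 0 0)%R = \int[gam]_x f x)%E.
Proof.
case: k g gg v => [|k'] h hg v v1 mf f0.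
  by move: v1; rewrite /sqn big_ord0 => /esym/eqP; rewrite oner_eq0.
have vv := unit_vectorE v1.
have [Q [_ Qinv Qv]] := gauss_invariant_to_delta vv.
have hX : gauss_matrix P (fun w => (h w)^T).
  have sI : injective (fun p : 'I_1 * 'I_k'.+1 => p.2).
    by move=> [i j] [i' j'] /= ->; rewrite !ord1.
  by apply: gauss_law_ext (gauss_law_reindex sI hg) => w [i j] /=; rewrite !mxE ord1.
pose F (M : 'rV[R]_k'.+1) : \bar R := f ((M *m v) 0 0).
have mF : measurable_fun setT (fun x => F (mx_of_cfg x)).
  apply: (measurableT_comp mf); apply: mx_measurableM; last exact: mx_measurable_cst.
  exact: mx_measurable_mx_of_cfg.
transitivity (\int[P]_w F (h w)^T)%E.
  apply: eq_integral => w _; rewrite /F; congr f.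
  by rewrite -[(h w)^T *m v]trmxK [RHS]mxE trmx_mul trmxK.
apply: (etrans (gauss_matrix_integral hX (Qinv _ _ _ _ _ hX) mF (fun=> f0 _))).
transitivity (\int[P]_w f (h w 0 0)%R)%E.
  apply: eq_integral => w _; rewrite /F; congr f.
  rewrite -mulmxA Qv mxE (bigD1 0)//= big1 ?addr0 => [|j j0].
    by rewrite !mxE !eqxx mulr1.
  by rewrite [X in _ * X]mxE (negPf j0) mulr0.
pose f' (x : cfg R 'I_1) : \bar R := f (x 0).
have mf' : measurable_fun setT f' by apply: (measurableT_comp mf); exact: measurable_coord.
have gid : gauss_law gam (fun (x : measurableTypeR R) (_ : 'I_1) => x : R).
  split => [i|B mB]; first exact: measurable_id.
  rewrite (_ : _ @^-1` _ = B 0); last first.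
    by apply/seteqP; split => x /=; [move=> /(_ 0)|move=> Bx i; rewrite ord1].
  by rewrite big_ord1.
have uI : injective (fun _ : 'I_1 => 0 : 'I_k'.+1) by move=> i j _; rewrite !ord1.
exact: (gauss_law_integral (gauss_law_reindex uI hg) gid mf' (fun=> f0 _)).
Qed.

Lemma gauss_form_decomp (N : 'M[R]_k) : N^T = N -> (forall v, 0 <= quad N v) ->
  exists (b : 'I_k -> R) (v : 'I_k -> 'cV[R]_k),
    [/\ forall l, 0 <= b l, forall l, sqn (v l) = 1, \tr N = \sum_l b l &
        forall x, quad N x = \sum_l b l * ((v l)^T *m x) 0 0 ^+ 2].
Proof.
move=> NT N0; have [V [b [VV NE]]] := symmetric_diagonalization NT.
have vl l : (col l V)^T *m V = delta_mx 0 l.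
  by rewrite tr_col -row_mul VV row1.
exists (fun l => b 0 l), (fun l => col l V); split.
- move=> l; have := N0 (col l V); rewrite /quad NE !mulmxA vl.
  rewrite -!mulmxA -[V^T *m col l V]trmxK trmx_mul trmxK vl trmx_delta.
  by rewrite -colE -rowE !mxE eqxx mulr1n.
- by move=> l; rewrite -sqnE colE trmx_mul -mulmxA (mulmxA V^T) VV mul1mx
    trmx_delta mul_delta_mx mxE !eqxx.
- rewrite {1}NE mxtrace_mulC mulmxA VV mul1mx mxtrace_diag//.
- move=> x; rewrite /quad NE -!mulmxA.
  rewrite mulmxA -[x^T *m V]trmxK trmx_mul trmxK mxE; apply: eq_bigr => l _.
  rewrite mul_diag_mx !mxE mulrCA -expr2; congr (_ * _ ^+ 2).
  by apply: eq_bigr => i _; rewrite !mxE.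
Qed.

Let mg : mx_measurable g.
Proof. by move=> i j; rewrite ord1; exact: (gg.1 i). Qed.

Let mvg (v : 'cV[R]_k) : measurable_fun setT (fun w => (v^T *m g w) 0 0).
Proof. by apply: mx_measurableM => //; exact: mx_measurable_cst. Qed.

Lemma gauss_form_mean (N : 'M[R]_k) : N^T = N -> (forall v, 0 <= quad N v) ->
  (\int[P]_w (quad N (g w))%:E = (moment2 * \tr N)%:E)%E.
Proof.
move=> NT N0; have [b [v [b0 v1 trN NE]]] := gauss_form_decomp NT N0.
under eq_integral do rewrite NE -sumEFin.
rewrite ge0_integral_sum//; last 2 first.
- move=> l; apply/measurable_EFinP; apply: measurable_funM => //.
  exact: measurable_funX.
- by move=> l w _; rewrite lee_fin mulr_ge0 ?sqr_ge0.
rewrite trN mulr_sumr -sumEFin; apply: eq_bigr => l _.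
under eq_integral do rewrite EFinM.
rewrite ge0_integralZl//; last 3 first.
- by apply/measurable_EFinP; exact: measurable_funX.
- by move=> w _; rewrite lee_fin sqr_ge0.
- by rewrite lee_fin.
rewrite (@gauss_unit_integral (v l) (fun x => (x ^+ 2)%:E))//; last 2 first.
- by apply/measurable_EFinP; exact: exprn_measurable.
- by move=> x; rewrite lee_fin sqr_ge0.
by rewrite moment2E -EFinM mulrC.
Qed.

(** Cauchy-Schwarz with the eigenvalues as weights reduces the square of the form to fourth powers
    of the single coordinates [v_l^T g], each of mean [3 moment2^2]. *)
Lemma gauss_form_square (N : 'M[R]_k) : N^T = N -> (forall v, 0 <= quad N v) ->
  (\int[P]_w (quad N (g w) ^+ 2)%:E <= (3 * (moment2 * \tr N) ^+ 2)%:E)%E.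
Proof.
move=> NT N0; have [b [v [b0 v1 trN NE]]] := gauss_form_decomp NT N0.
have cs w : quad N (g w) ^+ 2 <= \tr N * \sum_l b l * ((v l)^T *m g w) 0 0 ^+ 4.
  rewrite NE trN; set h := fun l => ((v l)^T *m g w) 0 0 ^+ 2.
  rewrite -subr_ge0.
  (* Lagrange's identity; the factor [2^-1] is there because each pair is counted in both orders. *)
  have -> : (\sum_l b l) * (\sum_l b l * ((v l)^T *m g w) 0 0 ^+ 4) -
      (\sum_l b l * ((v l)^T *m g w) 0 0 ^+ 2) ^+ 2 =
      2^-1 * \sum_i \sum_j b i * b j * (h i - h j) ^+ 2.
    pose s1 := \sum_l b l; pose s2 := \sum_l b l * h l; pose s3 := \sum_l b l * h l ^+ 2.
    have -> : \sum_l b l * ((v l)^T *m g w) 0 0 ^+ 4 = s3.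
      by apply: eq_bigr => l _; rewrite /h -exprM.
    have -> : \sum_i \sum_j b i * b j * (h i - h j) ^+ 2 =
        \sum_i (b i * h i ^+ 2 * s1 - 2 * (b i * h i) * s2 + b i * s3).
      apply: eq_bigr => i _; rewrite /s1 /s2 /s3 !mulr_sumr -sumrB -big_split/=.
      by apply: eq_bigr => j _; ring.
    rewrite big_split/= sumrB -!mulr_suml -mulr_sumr -/s1 -/s2 -/s3.
    by field.
  rewrite mulr_ge0//; apply: sumr_ge0 => i _; apply: sumr_ge0 => j _.
  by rewrite mulr_ge0 ?sqr_ge0// mulr_ge0.
have trN0 : 0 <= \tr N by rewrite trN sumr_ge0.
apply: (@le_trans _ _ (\int[P]_w (\tr N * \sum_l b l * ((v l)^T *m g w) 0 0 ^+ 4)%:E)%E).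
  apply: ge0_le_integral => //.
  - by move=> w _; rewrite lee_fin sqr_ge0.
  - apply/measurable_EFinP; apply: measurable_funX; exact: measurable_quad.
  - apply/measurable_EFinP; apply: measurable_funM => //; apply: measurable_sum => l.
    by apply: measurable_funM => //; exact: measurable_funX.
  - by move=> w _; rewrite lee_fin; exact: cs.
under eq_integral do rewrite EFinM.
have b4 l w : 0 <= b l * ((v l)^T *m g w) 0 0 ^+ 4 by rewrite mulr_ge0// exprn_even_ge0.
rewrite ge0_integralZl//; last 2 first.
- apply/measurable_EFinP; apply: measurable_sum => l.
  by apply: measurable_funM => //; exact: measurable_funX.
- by move=> w _; rewrite lee_fin sumr_ge0.
under eq_integral do rewrite -sumEFin.
rewrite ge0_integral_sum//; last 2 first.
- move=> l; apply/measurable_EFinP; apply: measurable_funM => //.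
  exact: measurable_funX.
- by move=> l w _; rewrite lee_fin.
have -> : (\sum_l \int[P]_w (b l * ((v l)^T *m g w) 0 0 ^+ 4)%:E =
    (\sum_l b l * (3 * moment2 ^+ 2))%:E)%E.
  rewrite -sumEFin; apply: eq_bigr => l _.
  under eq_integral do rewrite EFinM.
  rewrite ge0_integralZl//; last 3 first.
  - by apply/measurable_EFinP; exact: measurable_funX.
  - by move=> w _; rewrite lee_fin exprn_even_ge0.
  - by rewrite lee_fin.
  rewrite (@gauss_unit_integral (v l) (fun x => (x ^+ 4)%:E))//; last 2 first.
  - by apply/measurable_EFinP; exact: exprn_measurable.
  - by move=> x; rewrite lee_fin exprn_even_ge0.
  by rewrite moment4E -EFinM.
rewrite -EFinM lee_fin -mulr_suml -trN le_eqVlt; apply/orP; left; apply/eqP.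
by ring.
Qed.

End GaussianForms.

(** * Conditioning on all but one column *)

Section ConditionalBound.
Context {R : realType} d (T : measurableType d) (P : probability T R).

Lemma ge0_integral_EFinM (f : T -> R) (a : R) :
  measurable_fun setT f -> (forall w, 0 <= f w) -> 0 <= a ->
  (\int[P]_w (a * f w)%:E = a%:E * \int[P]_w (f w)%:E)%E.
Proof.
move=> mf f0 a0; under eq_integral do rewrite EFinM.
apply: ge0_integralZl => //; first exact/measurable_EFinP.
by move=> w _; rewrite lee_fin.
Qed.

Lemma ge0_integral_EFinD (f g : T -> R) :
  measurable_fun setT f -> (forall w, 0 <= f w) ->
  measurable_fun setT g -> (forall w, 0 <= g w) ->
  (\int[P]_w (f w + g w)%:E = \int[P]_w (f w)%:E + \int[P]_w (g w)%:E)%E.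
Proof.
move=> mf f0 mg g0; under eq_integral do rewrite EFinD.
apply: ge0_integralD => //; try exact/measurable_EFinP.
- by move=> w _; rewrite lee_fin.
- by move=> w _; rewrite lee_fin.
Qed.

(* For every [b] one has [y / (1 + y) >= 2 b y - b^2 (y + y^2)]; take [b = 1 / (1 + 3 z)]. *)
Lemma ratio_mean (y : T -> R) (z : R) :
  measurable_fun setT y -> (forall w, 0 <= y w) -> 0 < z ->
  (\int[P]_w (y w)%:E = z%:E)%E ->
  (\int[P]_w (y w ^+ 2)%:E <= (3 * z ^+ 2)%:E)%E ->
  ((z / (1 + 3 * z))%:E <= \int[P]_w (y w / (1 + y w))%:E)%E.
Proof.
move=> my y0 z0 Ey Ey2; pose b : R := (1 + 3 * z)^-1.
have z3 : 0 < 1 + 3 * z by rewrite addr_gt0// mulr_gt0.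
have b0 : 0 <= b by rewrite invr_ge0 ltW.
have y1 w : 0 < 1 + y w by rewrite ltr_pwDl.
have mF : measurable_fun setT (fun w => y w / (1 + y w)).
  apply: measurable_funM => //; apply: measurable_inv => [w|].
    by rewrite gt_eqF.
  exact: measurable_funD.
have my2 : measurable_fun setT (fun w => y w ^+ 2) by exact: measurable_funX.
have F0 w : 0 <= y w / (1 + y w) by rewrite divr_ge0// ltW.
have pw w : 2 * b * y w <= y w / (1 + y w) + b ^+ 2 * (y w + y w ^+ 2).
  rewrite -subr_ge0.
  have -> : y w / (1 + y w) + b ^+ 2 * (y w + y w ^+ 2) - 2 * b * y w =
      y w / (1 + y w) * (1 - b * (1 + y w)) ^+ 2.
    by field; rewrite gt_eqF.
  by rewrite mulr_ge0 ?sqr_ge0.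
have my12 : measurable_fun setT (fun w => y w + y w ^+ 2) by exact: measurable_funD.
have y12 w : 0 <= y w + y w ^+ 2 by rewrite addr_ge0 ?sqr_ge0.
have : (\int[P]_w (2 * b * y w)%:E <=
    \int[P]_w (y w / (1 + y w) + b ^+ 2 * (y w + y w ^+ 2))%:E)%E.
  apply: ge0_le_integral => //.
  - by move=> w _; rewrite lee_fin !mulr_ge0.
  - by apply/measurable_EFinP; exact: measurable_funM.
  - apply/measurable_EFinP; apply: measurable_funD => //.
    exact: measurable_funM.
  - by move=> w _; rewrite lee_fin.
rewrite ge0_integral_EFinM ?mulr_ge0// ge0_integral_EFinD//; last 2 first.
- exact: measurable_funM.
- by move=> w; rewrite mulr_ge0 ?sqr_ge0.
rewrite ge0_integral_EFinM ?sqr_ge0// ge0_integral_EFinD//; last by move=> w; rewrite sqr_ge0.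
rewrite Ey => h.
(* By the choice of [b], [b^2 (z + 3 z^2) = b z], so that [2 b z - b z = z / (1 + 3 z)] is left. *)
have h2 : ((b ^+ 2)%:E * (z%:E + \int[P]_w (y w ^+ 2)%:E) <= (b * z)%:E)%E.
  apply: (@le_trans _ _ ((b ^+ 2)%:E * (z%:E + (3 * z ^+ 2)%:E))%E).
    by apply: lee_wpmul2l; [rewrite lee_fin sqr_ge0|exact: leeD2l].
  rewrite -EFinD -EFinM lee_fin le_eqVlt; apply/orP; left; apply/eqP.
  by rewrite /b; field; rewrite gt_eqF.
have := le_trans h (leeD2l _ h2).
rewrite -EFinM -leeBlDr// -EFinB; apply: le_trans.
rewrite lee_fin le_eqVlt; apply/orP; left; apply/eqP.
by rewrite /b; field; rewrite gt_eqF.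
Qed.

(* [2 c - c^2 x <= 1 / x] linearizes the bound [1 / (3 + 1 / z)] of [ratio_mean], so that [H], which
   depends on the other columns of the sketch, can be averaged afterwards. *)
Lemma gauss_ratio_mean k (g : T -> 'cV[R]_k.+1) (N : 'M[R]_k.+1) (a H c : R) :
  gauss_law P (fun w i => g w i 0) -> N^T = N -> (forall v, 0 <= quad N v) ->
  0 < a -> 1 <= moment2 * (a * \tr N) * H ->
  ((2 * c - c ^+ 2 * (3 + H))%:E <=
    \int[P]_w (a * quad N (g w) / (1 + a * quad N (g w)))%:E)%E.
Proof.
move=> gg NT N0 a0; set z := moment2 * (a * \tr N) => zH.
have aN : moment2 * \tr (a *: N) = z by rewrite linearZ.
have trN0 : 0 <= \tr N.
  by apply: sumr_ge0 => i _; rewrite -quad_delta.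
have z0 : 0 < z.
  have : 0 <= z by rewrite !mulr_ge0// ltW// moment2_gt0.
  rewrite le_eqVlt => /orP[/eqP zE|//].
  by move: zH; rewrite -zE mul0r ler10.
have aNq v : a * quad N v = quad (a *: N) v.
  by rewrite /quad -scalemxAr -scalemxAl scalemxE.
have aNT : (a *: N)^T = a *: N by rewrite linearZ/= NT.
have aN0 v : 0 <= quad (a *: N) v by rewrite -aNq mulr_ge0// ltW.
apply: (@le_trans _ _ (z / (1 + 3 * z))%:E).
  rewrite lee_fin.
  have Hz : z^-1 <= H by rewrite -[leLHS]mul1r ler_pdivrMr// mulrC.
  have : 2 * c - c ^+ 2 * (3 + H) <= 2 * c - c ^+ 2 * (3 + z^-1).
    by rewrite lerD2l lerN2 ler_wpM2l ?sqr_ge0// lerD2l.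
  move=> /le_trans; apply; rewrite -subr_ge0.
  have z3 : 0 < 1 + 3 * z by rewrite addr_gt0// mulr_gt0.
  have -> : z / (1 + 3 * z) - (2 * c - c ^+ 2 * (3 + z^-1)) =
      z / (1 + 3 * z) * (1 - c * ((1 + 3 * z) / z)) ^+ 2.
    by field; rewrite !gt_eqF.
  by rewrite mulr_ge0 ?sqr_ge0// divr_ge0// ltW.
under eq_integral do rewrite aNq.
apply: ratio_mean => //.
- apply: measurable_quad; first exact: mx_measurable_cst.
  by move=> i j; rewrite ord1; exact: (gg.1 i).
- by rewrite gauss_form_mean// aN.
- by rewrite -aN; exact: gauss_form_square.
Qed.

End ConditionalBound.

(** * Mean ridge residual of one row on the others *)

Section RowRemoval.
Context {R : realType}.

Lemma row'_mul m n p (l : 'I_m) (A : 'M[R]_(m, n)) (B : 'M[R]_(n, p)) :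
  row' l (A *m B) = row' l A *m B.
Proof. by apply/matrixP => i j; rewrite !mxE; apply: eq_bigr => q _; rewrite mxE. Qed.

Lemma gauss_matrix_row d (T : measurableType d) (P : probability T R) k m
    (X : T -> 'M[R]_(k, m)) l :
  gauss_matrix P X -> gauss_law P (fun w i => (row l (X w))^T i 0).
Proof.
have lI : injective (fun i : 'I_m => (l, i)) by move=> i j [].
move=> /(gauss_law_reindex lI); apply: gauss_law_ext => w i.
by rewrite !mxE.
Qed.

Lemma gauss_matrix_row' d (T : measurableType d) (P : probability T R) k m
    (X : T -> 'M[R]_(k, m)) l :
  gauss_matrix P X -> gauss_matrix P (fun w => row' l (X w)).
Proof.
have lI : injective (fun p : 'I_k.-1 * 'I_m => (lift l p.1, p.2)).
  by move=> [i j] [i' j'] /pair_equal_spec[/= /lift_inj-> ->].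
move=> /(gauss_law_reindex lI); apply: gauss_law_ext => w p.
by rewrite !mxE.
Qed.

(** Regularized counterpart of the squared Frobenius error. As [1 - rproj X t] is not idempotent in
    general, this differs from the squared norm of [A (1 - rproj X t)]; being linear in [rproj], it
    is what averaging a row residual produces. *)
Definition resid m n k (A : 'M[R]_(m, n)) (X : 'M[R]_(k, n)) (t : R) : R :=
  \tr (A *m (1%:M - rproj X t) *m A^T).

Lemma residE m n k (A : 'M[R]_(m, n)) (X : 'M[R]_(k, n)) (t : R) :
  resid A X t = \sum_i quad (1%:M - rproj X t) (row i A)^T.
Proof.
apply: eq_bigr => i _; rewrite /quad trmxK.
by rewrite -row_mul tr_row colE mulmxA -colE [RHS]mxE -row_mul [RHS]mxE.
Qed.

Lemma resid_ge0 m n k (A : 'M[R]_(m, n)) (X : 'M[R]_(k, n)) (t : R) : 0 < t ->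
  0 <= resid A X t.
Proof. by move=> t0; rewrite residE sumr_ge0// => i _; rewrite quad_rprojC_ge0. Qed.

Lemma mx_measurable_rprojC d (T : measurableType d) k n (X : T -> 'M[R]_(k, n)) (t : R) :
  0 < t -> mx_measurable X -> mx_measurable (fun w => 1%:M - rproj (X w) t).
Proof.
move=> t0 mX i j; under eq_fun do rewrite addmxE oppmxE.
apply: measurable_funB; first exact: measurable_cst.
exact: mx_measurable_rproj.
Qed.

Lemma measurable_resid d (T : measurableType d) m n k (A : 'M[R]_(m, n))
    (X : T -> 'M[R]_(k, n)) (t : R) :
  0 < t -> mx_measurable X -> measurable_fun setT (fun w => resid A (X w) t).
Proof.
move=> t0 mX; apply: measurable_mxtrace; apply: mx_measurableM.
  apply: mx_measurableM; first exact: mx_measurable_cst.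
  exact: mx_measurable_rprojC.
exact: mx_measurable_cst.
Qed.

(** Row [l] is redrawn independently of the others. Given these, the residual is the quadratic form
    of [A (1 - P_t) A^T] in a standard Gaussian vector, whose mean is [moment2] times the trace; the
    remaining [k] rows have the law of [X']. *)
Lemma gauss_row_resid d (T : measurableType d) (P : probability T R)
    d' (T' : measurableType d') (P' : probability T' R) k m n
    (X : T -> 'M[R]_(k.+1, m)) (X' : T' -> 'M[R]_(k, m)) (A : 'M[R]_(m, n)) (t : R) l :
  0 < t -> gauss_matrix P X -> gauss_matrix P' X' ->
  (\int[P]_w (quad (1%:M - rproj (row' l (X w *m A)) t) (row l (X w *m A))^T)%:E =
   moment2%:E * \int[P']_w (resid A (X' w *m A) t)%:E)%E.
Proof.
move=> t0 gX gX'.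
pose F (M : 'M[R]_(k.+1, m)) : \bar R :=
  (quad (1%:M - rproj (row' l (M *m A)) t) (row l (M *m A))^T)%:E.
have F0 M : (0 <= F M)%E by rewrite lee_fin quad_rprojC_ge0.
have mF e (U : measurableType e) (Z : U -> 'M[R]_(k.+1, m)) : mx_measurable Z ->
    measurable_fun setT (fun x => F (Z x)).
  move=> /(mx_measurable_mulr A) mZ; apply/measurable_EFinP; apply: measurable_quad.
    by apply: mx_measurable_rprojC => //; exact: mx_measurable_row'.
  by apply: mx_measurable_tr; exact: mx_measurable_row.
pose Z (z : T * T) : 'M[R]_(k.+1, m) :=
  \matrix_(i, j) if i != l then X z.1 i j else X z.2 i j.
have gZ : gauss_matrix (P \x P)%E Z.
  apply: gauss_law_ext (gauss_law_mix (fun p => p.1 != l) gX gX) => z p.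
  by rewrite mxE.
have mZ := gauss_matrix_measurable gZ.
transitivity (\int[(P \x P)%E]_z F (Z z))%E.
  exact: (gauss_matrix_integral gX gZ (mF _ _ _ (@mx_measurable_mx_of_cfg _ _ _)) F0).
rewrite fubini_tonelli1//; last exact: mF.
transitivity (\int[P]_w (moment2 * resid A (row' l (X w) *m A) t)%:E)%E.
  apply: eq_integral => w _; rewrite /fubini_F.
  set N := 1%:M - rproj (row' l (X w) *m A) t.
  have NT : N^T = N by rewrite /N linearB/= trmx1 tr_rproj.
  have N0 v : 0 <= quad N v by rewrite quad_rprojC_ge0.
  have AN0 v : 0 <= quad (A *m N *m A^T) v.
    by have := N0 (A^T *m v); rewrite /quad trmx_mul trmxK !mulmxA.
  have ANT : (A *m N *m A^T)^T = A *m N *m A^T by rewrite !trmx_mul trmxK NT mulmxA.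
  rewrite -(gauss_form_mean (gauss_matrix_row l gX) ANT AN0).
  apply: eq_integral => w' _; rewrite /F row'_mul row_mul; congr (_%:E).
  have -> : row' l (Z (w, w')) = row' l (X w).
    by apply/matrixP => i j; rewrite !mxE/= eq_sym neq_lift.
  have -> : row l (Z (w, w')) = row l (X w').
    by apply/rowP => j; rewrite !mxE/= eqxx.
  by rewrite -/N /quad !trmxK trmx_mul !mulmxA.
have mr e (U : measurableType e) (Y : U -> 'M[R]_(k, m)) : mx_measurable Y ->
    measurable_fun setT (fun w => resid A (Y w *m A) t).
  by move=> mY; apply: measurable_resid => //; exact: mx_measurable_mulr.
have gX1 := gauss_matrix_row' l gX.
rewrite ge0_integral_EFinM; last 3 first.
- by apply: mr; exact: gauss_matrix_measurable gX1.
- by move=> w; exact: resid_ge0.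
- by rewrite ltW// moment2_gt0.
congr (_ * _)%E.
apply: (gauss_matrix_integral (F := fun M => (resid A (M *m A) t)%:E) gX1 gX').
  by apply/measurable_EFinP; apply: mr; exact: mx_measurable_mx_of_cfg.
by move=> M; rewrite lee_fin resid_ge0.
Qed.

End RowRemoval.

(** * Lower bound along a singular direction for fixed [t] *)

Section SketchBound.
Context {R : realType}.

Lemma probability_integral_cst d (T : measurableType d) (P : probability T R) (a : R) :
  (\int[P]_w a%:E)%E = a%:E.
Proof. by rewrite integral_cst// [X in (_ * X)%E](@probability_setT _ _ _ P) mule1. Qed.

Lemma gauss_matrix_col d (T : measurableType d) (P : probability T R) k m
    (X : T -> 'M[R]_(k, m)) l :
  gauss_matrix P X -> gauss_law P (fun w i => col l (X w) i 0).
Proof.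
have lI : injective (fun i : 'I_k => (i, l)) by move=> i j [].
move=> /(gauss_law_reindex lI); apply: gauss_law_ext => w i.
by rewrite mxE.
Qed.

Lemma quadZ n (N : 'M[R]_n) (a : R) v : quad N (a *: v) = a ^+ 2 * quad N v.
Proof.
by rewrite /quad [(_ *: _)^T]linearZ/= -!scalemxAl -scalemxAr !scalemxE mulrA.
Qed.

(** For [u] the first basis vector, row 0 of [A] is [s v^T], so [A (1 - v v^T)] has zero row 0. Thus
    [Y] ignores column 0 of the sketch while [X A v] is [s] times that column, and redrawing column
    0 alone separates the two. *)
Lemma sketch_bound_delta d (T : measurableType d) (P : probability T R)
    d' (T' : measurableType d') (P' : probability T' R) k m n
    (X : T -> 'M[R]_(k.+1, m.+1)) (X' : T' -> 'M[R]_(k, m.+1)) (A : 'M[R]_(m.+1, n))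
    (v : 'cV[R]_n) (s t c e : R) :
  gauss_matrix P X -> gauss_matrix P' X' ->
  sqn v = 1 -> 0 < s -> 0 < t -> 0 <= c ->
  A *m v = s *: delta_mx 0 0 -> A^T *m delta_mx 0 0 = s *: v ->
  (\int[P']_w (resid A (X' w *m A) t)%:E)%E = e%:E ->
  ((2 * c - c ^+ 2 * (3 + (t / moment2 + e) / (s ^+ 2 * k.+1%:R)))%:E <=
    \int[P]_w (quad (rproj (X w *m A) t) v)%:E)%E.
Proof.
move=> gX gX' v1 s0 t0 c0 Av Atu Ee.
have mX := gauss_matrix_measurable gX.
have c2 := @moment2_gt0 R.
have vv := unit_vectorE v1.
have rA : row 0 A = s *: v^T.
  by rewrite rowE -[_ *m A]trmxK trmx_mul trmx_delta Atu [LHS]linearZ.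
(* Normalization for which [mxtrace_invgram_ge] reads [1 <= z H], with [z] the conditional mean of
   [y]. *)
pose K : R := moment2 * s ^+ 2 * k.+1%:R ^+ 2.
have K0 : 0 < K by rewrite !mulr_gt0 ?exprn_gt0.
pose F (M : 'M[R]_(k.+1, m.+1)) : \bar R := (quad (rproj (M *m A) t) v)%:E.
have F0 M : (0 <= F M)%E by rewrite lee_fin quad_rproj_ge0.
have mF e' (U : measurableType e') (Z : U -> 'M[R]_(k.+1, m.+1)) : mx_measurable Z ->
    measurable_fun setT (fun x => F (Z x)).
  move=> /(mx_measurable_mulr A) mZ; apply/measurable_EFinP; apply: measurable_quad.
    exact: mx_measurable_rproj.
  exact: mx_measurable_cst.
pose Z (z : T * T) : 'M[R]_(k.+1, m.+1) :=
  \matrix_(i, j) if j != 0 then X z.1 i j else X z.2 i j.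
have gZ : gauss_matrix (P \x P)%E Z.
  apply: gauss_law_ext (gauss_law_mix (fun p => p.2 != 0) gX gX) => z p.
  by rewrite mxE.
have mZ := gauss_matrix_measurable gZ.
have mFZ := mF _ _ _ mZ.
pose G := fubini_F P (fun z => F (Z z)).
have mG : measurable_fun setT G by exact: measurable_fun_fubini_tonelli_F.
have G0 w : (0 <= G w)%E by apply: integral_ge0 => w' _; exact: F0.
have EG : (\int[P]_w F (X w) = \int[P]_w G w)%E.
  rewrite -fubini_tonelli1//.
  exact: (gauss_matrix_integral gX gZ (mF _ _ _ (@mx_measurable_mx_of_cfg _ _ _)) F0).
rewrite [leRHS]EG.
pose q l w : R := quad (1%:M - rproj (row' l (X w *m A)) t) (row l (X w *m A))^T.
have q0 l w : 0 <= q l w by exact: quad_rprojC_ge0.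
have mq l : measurable_fun setT (q l).
  have mXA := mx_measurable_mulr A mX.
  apply: measurable_quad.
    by apply: mx_measurable_rprojC => //; exact: mx_measurable_row'.
  by apply: mx_measurable_tr; exact: mx_measurable_row.
pose H w : R := K^-1 * \sum_l (t + q l w).
have H0 w : 0 <= H w.
  by rewrite mulr_ge0 ?invr_ge0 ?(ltW K0)// sumr_ge0// => l _; rewrite addr_ge0// ltW.
have msum : measurable_fun setT (fun w => \sum_l (t + q l w)).
  by apply: measurable_sum => l; apply: measurable_funD => //; exact: measurable_cst.
have mH : measurable_fun setT H by apply: measurable_funM => //; exact: measurable_cst.
(* [H] stays on the side of [G], so that both sides can be integrated as nonnegative functions. *)
have GH w : ((2 * c)%:E <= G w + (c ^+ 2 * (3 + H w))%:E)%E.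
  rewrite -leeBlDr// -EFinB.
  pose Y := X w *m A *m (1%:M - v *m v^T).
  have YXA a : sqn (Y^T *m a) <= sqn ((X w *m A)^T *m a) by exact: sqn_complement.
  have NT := tr_invgram Y t.
  have s20 : 0 < s ^+ 2 by rewrite exprn_gt0.
  have h : 1 <= moment2 * (s ^+ 2 * \tr (invmx (gram Y t))) * H w.
    have := mxtrace_invgram_ge t0 YXA.
    set trY := \tr _; rewrite -[\sum_l _]/(\sum_l (t + q l w)) => qk.
    have -> : moment2 * (s ^+ 2 * trY) * H w =
        (\sum_l (t + q l w)) * trY / k.+1%:R ^+ 2.
      by rewrite /H /K; field; rewrite !gt_eqF.
    by rewrite ler_pdivlMr ?mul1r// exprn_gt0.
  apply: le_trans (gauss_ratio_mean c (gauss_matrix_col 0 gX) NT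
    (fun v => quad_invgram_ge0 Y v t0) s20 h) _.
  rewrite le_eqVlt; apply/orP; left; apply/eqP; apply: eq_integral => w' _.
  congr (_%:E); rewrite quad_rproj_rank1//.
  have ZA : Z (w, w') *m A *m (1%:M - v *m v^T) = Y.
    rewrite /Y -!mulmxA; set B := A *m _.
    have B0 j : B 0 j = 0.
      have -> : B 0 j = (row 0 B) 0 j by rewrite [RHS]mxE.
      rewrite /B row_mul rA -scalemxAl mulmxBr mulmx1 mulmxA vv mul1mx subrr.
      by rewrite scaler0 mxE.
    clearbody B; apply/matrixP => i j; rewrite !mxE; apply: eq_bigr => l _; rewrite !mxE/=.
    by have [->|//] := eqVneq l 0; rewrite B0 !mulr0.
  have ZAv : Z (w, w') *m A *m v = s *: col 0 (X w').
    rewrite -mulmxA Av -scalemxAr -colE; congr (_ *: _).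
    by apply/colP => i; rewrite !mxE.
  by rewrite ZA ZAv quadZ.
have EH : (\int[P]_w (H w)%:E = ((t / moment2 + e) / (s ^+ 2 * k.+1%:R))%:E)%E.
  rewrite ge0_integral_EFinM//; last 2 first.
  - by move=> w; rewrite sumr_ge0// => l _; rewrite addr_ge0// ltW.
  - by rewrite invr_ge0 ltW.
  under eq_integral do rewrite -sumEFin.
  rewrite ge0_integral_sum//; last 2 first.
  - by move=> l; apply/measurable_EFinP; apply: measurable_funD.
  - by move=> l w _; rewrite lee_fin addr_ge0// ltW.
  have -> : (\sum_(l < k.+1) \int[P]_w (t + q l w)%:E =
      (\sum_(l < k.+1) (t + moment2 * e))%:E)%E.
    rewrite -sumEFin; apply: eq_bigr => l _.
    rewrite ge0_integral_EFinD//; last by move=> w; rewrite ltW.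
    rewrite probability_integral_cst EFinD; congr (_ + _)%E.
    by rewrite (gauss_row_resid _ _ t0 gX gX') Ee.
  rewrite -EFinM; congr (_%:E).
  rewrite sumr_const card_ord -mulr_natl /K; field.
  by rewrite !gt_eqF.
have m3H : measurable_fun setT (fun w => 3 + H w).
  by apply: measurable_funD => //; exact: measurable_cst.
have mcH : measurable_fun setT (fun w => c ^+ 2 * (3 + H w)).
  by apply: measurable_funM => //; exact: measurable_cst.
have : (\int[P]_w (2 * c)%:E <= \int[P]_w (G w + (c ^+ 2 * (3 + H w))%:E))%E.
  apply: ge0_le_integral => //.
  - by move=> w _; rewrite lee_fin mulr_ge0.
  - by apply: emeasurable_funD => //; exact/measurable_EFinP.
rewrite probability_integral_cst ge0_integralD//; last 2 first.
- by move=> w _; rewrite lee_fin mulr_ge0 ?sqr_ge0// addr_ge0.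
- exact/measurable_EFinP.
rewrite ge0_integral_EFinM ?sqr_ge0//; last by move=> w; rewrite addr_ge0.
rewrite ge0_integral_EFinD// probability_integral_cst EH -EFinD -EFinM.
by rewrite -leeBlDr// -EFinB.
Qed.

End SketchBound.

Section SketchBoundGeneral.
Context {R : realType}.

Lemma orthogonal_cancel m (Q : 'M[R]_m) (u e : 'cV[R]_m) :
  Q *m Q^T = 1%:M -> Q *m u = e -> Q^T *m e = u.
Proof. by move=> /mulmx1C QQ <-; rewrite mulmxA QQ mul1mx. Qed.

(** Reduction to the special case by replacing [A] with [Q A], where [Q u] is the first basis
    vector. [X Q] has the law of [X], and the residual trace is unchanged under left multiplication
    of [A] by an orthogonal matrix. *)
Lemma sketch_bound d (T : measurableType d) (P : probability T R)
    d' (T' : measurableType d') (P' : probability T' R) k m n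
    (X : T -> 'M[R]_(k.+1, m)) (X' : T' -> 'M[R]_(k, m)) (A : 'M[R]_(m, n))
    (u : 'cV[R]_m) (v : 'cV[R]_n) (s t c e : R) :
  gauss_matrix P X -> gauss_matrix P' X' ->
  sqn u = 1 -> sqn v = 1 -> 0 < s -> 0 < t -> 0 <= c ->
  A *m v = s *: u -> A^T *m u = s *: v ->
  (\int[P']_w (resid A (X' w *m A) t)%:E)%E = e%:E ->
  ((2 * c - c ^+ 2 * (3 + (t / moment2 + e) / (s ^+ 2 * k.+1%:R)))%:E <=
    \int[P]_w (quad (rproj (X w *m A) t) v)%:E)%E.
Proof.
case: m X X' A u => [|m] X X' A u gX gX' u1 v1 s0 t0 c0 Av Atu Ee.
  by move: u1; rewrite /sqn big_ord0 => /esym/eqP; rewrite oner_eq0.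
have [Q [QQ Qinv Qu]] := gauss_invariant_to_delta (unit_vectorE u1).
have AvQ : Q *m A *m v = s *: delta_mx 0 0 by rewrite -mulmxA Av -scalemxAr Qu.
have AtuQ : (Q *m A)^T *m delta_mx 0 0 = s *: v.
  by rewrite trmx_mul -mulmxA (orthogonal_cancel QQ Qu).
have EeQ : (\int[P']_w (resid (Q *m A) (X' w *m (Q *m A)) t)%:E)%E = e%:E.
  rewrite -Ee; transitivity (\int[P']_w (resid A (X' w *m Q *m A) t)%:E)%E.
    apply: eq_integral => w _; rewrite mulmxA /resid trmx_mul.
    by rewrite -!mulmxA mxtrace_mulC !mulmxA -(mulmxA _ Q^T) (mulmx1C QQ) mulmx1.
  apply: (gauss_matrix_integral (F := fun M => (resid A (M *m A) t)%:E)
    (Qinv _ _ _ _ _ gX') gX').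
  - apply/measurable_EFinP; apply: measurable_resid => //.
    by apply: mx_measurable_mulr; exact: mx_measurable_mx_of_cfg.
  - by move=> M; rewrite lee_fin resid_ge0.
apply: le_trans (sketch_bound_delta gX gX' v1 s0 t0 c0 AvQ AtuQ EeQ) _.
rewrite le_eqVlt; apply/orP; left; apply/eqP.
transitivity (\int[P]_w (quad (rproj (X w *m Q *m A) t) v)%:E)%E.
  by apply: eq_integral => w _; rewrite mulmxA.
apply: (gauss_matrix_integral (F := fun M => (quad (rproj (M *m A) t) v)%:E)
  (Qinv _ _ _ _ _ gX) gX).
- apply/measurable_EFinP; apply: measurable_quad; last exact: mx_measurable_cst.
  apply: mx_measurable_rproj => //.
  by apply: mx_measurable_mulr; exact: mx_measurable_mx_of_cfg.
- by move=> M; rewrite lee_fin quad_rproj_ge0.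
Qed.

(** With [D] the sign change of coordinate 0 and [J] the reflection along [u], [D Q = Q J]. The laws
    of [X J], [X Q J = X D Q], [X Q] and [X] then agree in turn. *)
Lemma gauss_reflection_integral d (T : measurableType d) (P : probability T R) k m
    (X : T -> 'M[R]_(k, m)) (u : 'cV[R]_m) (F : 'M[R]_(k, m) -> \bar R) :
  gauss_matrix P X -> sqn u = 1 ->
  (forall d' (T' : measurableType d') (Y : T' -> 'M[R]_(k, m)), mx_measurable Y ->
    measurable_fun setT (fun w => F (Y w))) ->
  (forall M, 0 <= F M)%E ->
  (\int[P]_w F (X w *m (1%:M - 2 *: (u *m u^T))) = \int[P]_w F (X w))%E.
Proof.
case: m X u F => [|m] X u F gX u1 mF F0.
  by move: u1; rewrite /sqn big_ord0 => /esym/eqP; rewrite oner_eq0.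
have [Q [QQ Qinv Qu]] := gauss_invariant_to_delta (unit_vectorE u1).
have mFQ (B : 'M[R]_m.+1) : measurable_fun setT (fun x => F (@mx_of_cfg R k _ x *m B)).
  apply: (mF _ _ (fun x => mx_of_cfg x *m B)).
  by apply: mx_measurable_mulr; exact: mx_measurable_mx_of_cfg.
pose e0 : 'cV[R]_m.+1 := delta_mx 0 0.
pose D : 'M[R]_m.+1 := 1%:M - 2 *: (e0 *m e0^T).
have XD (M : 'M[R]_(k, m.+1)) i j : (M *m D) i j = if j == 0 then - M i j else M i j.
  rewrite mulmxBr mulmx1 -scalemxAr mulmxA -colE trmx_delta addmxE oppmxE scalemxE.
  have -> : (col 0 M *m delta_mx 0 0) i j = M i 0 * (j == 0)%:R.
    by rewrite mxE big_ord1 !mxE eqxx.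
  by have [->|j0] := eqVneq j 0; rewrite /= ?mulr1 ?mulr0 ?subr0//; ring.
have gXD : gauss_matrix P (fun w => X w *m D).
  apply: gauss_law_ext (gauss_law_opp (fun p => p.2 == 0) gX) => w p.
  by rewrite XD.
have uQ : e0^T *m Q = u^T.
  by rewrite -[e0^T *m Q]trmxK trmx_mul trmxK (orthogonal_cancel QQ Qu).
have DQ : D *m Q = Q *m (1%:M - 2 *: (u *m u^T)).
  rewrite mulmxBl mul1mx mulmxBr mulmx1 -scalemxAl -scalemxAr mulmxA Qu.
  by rewrite -mulmxA uQ.
transitivity (\int[P]_w F (X w *m Q *m (1%:M - 2 *: (u *m u^T))))%E.
  exact: (gauss_matrix_integral (F := fun M => F (M *m _)) gX (Qinv _ _ _ _ _ gX)).
transitivity (\int[P]_w F (X w *m D *m Q))%E.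
  by apply: eq_integral => w _; rewrite -!mulmxA DQ.
transitivity (\int[P]_w F (X w *m Q))%E.
  exact: (gauss_matrix_integral (F := fun M => F (M *m _)) gXD gX).
apply: (gauss_matrix_integral (Qinv _ _ _ _ _ gX) gX) => //.
by apply: mF; exact: mx_measurable_mx_of_cfg.
Qed.

End SketchBoundGeneral.

(** * The expected projector *)

Section Projector.
Context {R : realType}.

Definition proj k n (Y : 'M[R]_(k, n)) : 'M[R]_n := Defs.pinv Y *m Y.

Lemma tr_proj k n (Y : 'M[R]_(k, n)) : (proj Y)^T = proj Y.
Proof. by case: (pinvP Y). Qed.

Lemma proj_idem k n (Y : 'M[R]_(k, n)) : proj Y *m proj Y = proj Y.
Proof. by rewrite /proj; case: (pinvP Y) => _ YXY _ _; rewrite mulmxA YXY. Qed.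

Lemma quad_proj k n (Y : 'M[R]_(k, n)) v : quad (proj Y) v = sqn (proj Y *m v).
Proof. by rewrite -sqnE trmx_mul tr_proj mulmxA -(mulmxA v^T) proj_idem. Qed.

Lemma quad_proj_ge0 k n (Y : 'M[R]_(k, n)) v : 0 <= quad (proj Y) v.
Proof. by rewrite quad_proj sqn_ge0. Qed.

Lemma tr_projC k n (Y : 'M[R]_(k, n)) : (1%:M - proj Y)^T = 1%:M - proj Y.
Proof. by rewrite linearB/= trmx1 tr_proj. Qed.

Lemma projC_idem k n (Y : 'M[R]_(k, n)) :
  (1%:M - proj Y) *m (1%:M - proj Y) = 1%:M - proj Y.
Proof. by rewrite mulmxBr mulmx1 mulmxBl mul1mx proj_idem subrr subr0. Qed.

Lemma quad_projC k n (Y : 'M[R]_(k, n)) v :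
  quad (1%:M - proj Y) v = sqn ((1%:M - proj Y) *m v).
Proof. by rewrite -sqnE trmx_mul tr_projC mulmxA -(mulmxA v^T) projC_idem. Qed.

Lemma quad_proj_le k n (Y : 'M[R]_(k, n)) v : quad (proj Y) v <= sqn v.
Proof. by rewrite -subr_ge0 -{1}quad1 -quadB quad_projC sqn_ge0. Qed.

Lemma proj_orthogonal k n (Y : 'M[R]_(k, n)) (J : 'M[R]_n) : J *m J^T = 1%:M ->
  proj (Y *m J) = J^T *m proj Y *m J.
Proof.
move=> JJ; have [YXY XYX YXT XYT] := pinvP Y.
rewrite /proj (@is_pinv_uniq _ _ _ (Y *m J) (Defs.pinv (Y *m J)) (J^T *m Defs.pinv Y)).
- by rewrite !mulmxA.
- exact: pinvP.
have E1 : Y *m J *m (J^T *m Defs.pinv Y) = Y *m Defs.pinv Y.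
  by rewrite mulmxA -(mulmxA Y) JJ mulmx1.
split; rewrite ?E1.
- by rewrite mulmxA YXY.
- by rewrite -mulmxA E1 -mulmxA [Defs.pinv Y *m _]mulmxA XYX.
- exact: YXT.
- by rewrite mulmxA -(mulmxA J^T) trmx_mul [(J^T *m _)^T]trmx_mul trmxK XYT mulmxA.
Qed.

Lemma cvg_quad_rproj k n (Y : 'M[R]_(k, n)) v :
  quad (rproj Y (harmonic N)) v @[N --> \oo] --> quad (proj Y) v.
Proof.
pose C := sqn ((Defs.pinv Y)^T *m v).
apply: (@squeeze_cvgr _ _ _ _ (fun N => quad (proj Y) v - harmonic N * C)
  (fun=> quad (proj Y) v)).
- apply: nearW => N; have /andP[h1 h2] := pinv_rproj Y v (harmonic_gt0 N : 0 < harmonic N :> R).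
  by rewrite lerBlDr -lerBlDl h2 -subr_ge0.
- rewrite -[X in _ --> X]subr0 -[X in _ - X](mul0r C).
  apply: cvgB; first exact: cvg_cst.
  by apply: cvgM; [exact: cvg_harmonic|exact: cvg_cst].
- exact: cvg_cst.
Qed.

(** [pinv] is defined by choice and shows no measurability by itself; the quadratic form is a
    pointwise limit of measurable ones along [t = 1 / (N + 1)]. *)
Lemma measurable_quad_proj d (T : measurableType d) k n (Y : T -> 'M[R]_(k, n)) v :
  mx_measurable Y -> measurable_fun setT (fun w => quad (proj (Y w)) v).
Proof.
move=> mY; apply: (measurable_fun_cvg (h := fun N w => quad (rproj (Y w) (harmonic N)) v));
  last by move=> w _; exact: cvg_quad_rproj.
move=> N.
apply: measurable_quad; last exact: mx_measurable_cst.
by apply: mx_measurable_rproj => //; exact: harmonic_gt0.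
Qed.

Lemma quad_polarization n (N : 'M[R]_n) (u v : 'cV[R]_n) : N^T = N ->
  quad N (u + v) - quad N (u - v) = 4 * (u^T *m N *m v) 0 0.
Proof.
move=> NT; have S : (v^T *m N *m u) 0 0 = (u^T *m N *m v) 0 0.
  by rewrite -[v^T *m N *m u]trmxK [LHS]mxE !trmx_mul trmxK NT mulmxA.
rewrite /quad [(u + v)^T]linearD [(u - v)^T]linearB/=.
rewrite !(mulmxDl, mulmxDr, mulNmx, mulmxN, opprK, addmxE, oppmxE) S.
by ring.
Qed.

(** Carries integrability over from the quadratic forms to the matrix entries. *)
Lemma proj_polarization k n (Y : 'M[R]_(k, n)) i j : proj Y i j =
  4^-1 * (quad (proj Y) (delta_mx i 0 + delta_mx j 0) -
          quad (proj Y) (delta_mx i 0 - delta_mx j 0)).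
Proof.
rewrite quad_polarization ?tr_proj// trmx_delta -rowE -colE !mxE.
by field.
Qed.

Definition resid0 m n k (A : 'M[R]_(m, n)) (Y : 'M[R]_(k, n)) : R :=
  \sum_i quad (1%:M - proj Y) (row i A)^T.

Lemma frob_norm_resid0 m n k (A : 'M[R]_(m, n)) (Y : 'M[R]_(k, n)) :
  frob_norm (A *m (1%:M - proj Y)) ^+ 2 = resid0 A Y.
Proof.
rewrite /frob_norm sqr_sqrtr; last first.
  by apply: sumr_ge0 => i _; apply: sumr_ge0 => j _; rewrite sqr_ge0.
apply: eq_bigr => i _; rewrite quad_projC.
have -> : (1%:M - proj Y) *m (row i A)^T = (row i (A *m (1%:M - proj Y)))^T.
  by rewrite row_mul trmx_mul tr_projC.
by apply: eq_bigr => j _; rewrite [in RHS]mxE [in RHS]mxE.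
Qed.

Lemma cvg_resid m n k (A : 'M[R]_(m, n)) (Y : 'M[R]_(k, n)) :
  resid A Y (harmonic N) @[N --> \oo] --> resid0 A Y.
Proof.
under eq_fun do rewrite residE.
apply: cvg_big => [|i _]; first exact: add_continuous.
rewrite quadB; under eq_fun do rewrite quadB.
by apply: cvgB; [exact: cvg_cst|exact: cvg_quad_rproj].
Qed.

Lemma measurable_resid0 d (T : measurableType d) m n k (A : 'M[R]_(m, n))
    (Y : T -> 'M[R]_(k, n)) :
  mx_measurable Y -> measurable_fun setT (fun w => resid0 A (Y w)).
Proof.
move=> mY; apply: measurable_sum => i; under eq_fun do rewrite quadB.
apply: measurable_funB; first exact: measurable_cst.
exact: measurable_quad_proj.
Qed.

End Projector.

(** * Integrability and the limit of vanishing regularization *)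

Section ExpectedProjector.
Context {R : realType}.

Lemma gaussian_mx_gauss_matrix d (T : measurableType d) (P : probability T R) k m
    (S : 'I_k -> 'I_m -> {RV P >-> R}) :
  gaussian_mx S -> gauss_matrix P (rmx S).
Proof.
move=> [SN SI]; split => [p|B mB].
  rewrite (_ : (fun w => _) = S p.1 p.2); first exact: measurable_funP.
  by apply/funext => w; rewrite mxE.
pose J : {set 'I_k * 'I_m} := [set p | true]%SET.
have := SI J B (fun p _ => mB p); rewrite preimage_box.
have -> : \bigcap_(p in [set` J]) (S p.1 p.2 @^-1` B p) =
    \bigcap_(p in [set: 'I_k * 'I_m]) ((fun w => rmx S w p.1 p.2) @^-1` B p).
  apply/seteqP; split => w /= h p _; have := h p; rewrite /= mxE; apply => //.
  by rewrite /J finset.inE.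
move=> ->; apply: eq_big => [p|p _]; first by rewrite finset.inE.
exact: SN.
Qed.

Lemma bounded_integrable d (T : measurableType d) (P : probability T R)
    (f : T -> R) (b : R) :
  measurable_fun setT f -> (forall w, 0 <= f w <= b) ->
  P.-integrable setT (EFin \o f).
Proof.
move=> mf fb; have ib := finite_measure_integrable_cst P b measurableT.
apply: le_integrable ib => //; first exact/measurable_EFinP.
move=> w _ /=; have /andP[f0 f1] := fb w.
by rewrite lee_fin !ger0_norm// (le_trans f0).
Qed.

Lemma integrable_quad_proj d (T : measurableType d) (P : probability T R) k n
    (Y : T -> 'M[R]_(k, n)) v : mx_measurable Y ->
  P.-integrable setT (EFin \o (fun w => quad (proj (Y w)) v)).
Proof.
move=> mY; apply: (@bounded_integrable _ _ _ _ (sqn v)).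
  exact: measurable_quad_proj.
by move=> w; rewrite quad_proj_ge0 quad_proj_le.
Qed.

Lemma integrable_proj d (T : measurableType d) (P : probability T R) k n
    (Y : T -> 'M[R]_(k, n)) i j : mx_measurable Y ->
  P.-integrable setT (fun w => (proj (Y w) i j)%:E).
Proof.
move=> mY; pose q s w : R := quad (proj (Y w)) (delta_mx i 0 + s *: delta_mx j 0).
rewrite (_ : (fun w => _) = (fun w => (4^-1)%:E * ((q 1 w)%:E - (q (-1) w)%:E))%E).
  apply: integrableZl => //; apply: integrableB => //.
  - exact: integrable_quad_proj.
  - exact: integrable_quad_proj.
apply/funext => w; rewrite proj_polarization -EFinB -EFinM /q scale1r scaleN1r.
by [].
Qed.

Lemma expectation_mxE d (T : measurableType d) (P : probability T R) m n
    (M : T -> 'M[R]_(m, n)) i j :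
  expectation_mx P M i j = fine (\int[P]_w (M w i j)%:E)%E.
Proof. by rewrite mxE unlock. Qed.

Lemma quad_expectation_proj d (T : measurableType d) (P : probability T R) k n
    (Y : T -> 'M[R]_(k, n)) v : mx_measurable Y ->
  (\int[P]_w (quad (proj (Y w)) v)%:E)%E =
  (quad (expectation_mx P (fun w => proj (Y w))) v)%:E.
Proof.
move=> mY; have qE (N : 'M[R]_n) :
    quad N v = \sum_(p : 'I_n * 'I_n) v p.1 0 * v p.2 0 * N p.1 p.2.
  rewrite /quad mxE -(pair_bigA _ (fun i j => v i 0 * v j 0 * N i j))/= exchange_big/=.
  apply: eq_bigr => j _; rewrite mxE mulr_suml; apply: eq_bigr => i _.
  by rewrite mxE; ring.
under eq_integral do rewrite qE -sumEFin.
rewrite integral_sum//; last first.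
  move=> p; under eq_fun do rewrite EFinM.
  by apply: integrableZl => //; exact: integrable_proj.
rewrite qE -sumEFin; apply: eq_bigr => p _.
under eq_integral do rewrite EFinM.
rewrite integralZl//; last exact: integrable_proj.
rewrite [RHS]EFinM expectation_mxE fineK//; apply: integrable_fin_num => //.
exact: integrable_proj.
Qed.

Lemma tr_expectation_proj d (T : measurableType d) (P : probability T R) k n
    (Y : T -> 'M[R]_(k, n)) :
  (expectation_mx P (fun w => proj (Y w)))^T = expectation_mx P (fun w => proj (Y w)).
Proof.
apply/matrixP => i j; rewrite !mxE; congr (fine 'E_P[_])%E.
by apply/funext => w; rewrite -[in LHS]tr_proj mxE.
Qed.

Lemma quad_rproj_le k n (Y : 'M[R]_(k, n)) (t : R) v : 0 < t ->
  quad (rproj Y t) v <= quad (proj Y) v.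
Proof. by move=> t0; rewrite -subr_ge0; case/andP: (pinv_rproj Y v t0). Qed.

Lemma resid_le m n k (A : 'M[R]_(m, n)) (Y : 'M[R]_(k, n)) (t : R) : 0 < t ->
  resid A Y t <= \sum_i sqn (row i A)^T.
Proof.
move=> t0; rewrite residE; apply: ler_sum => i _.
by rewrite quadB quad1 lerBlDr lerDl quad_rproj_ge0.
Qed.

Lemma resid_integral_fin d (T : measurableType d) (P : probability T R) k m n
    (A : 'M[R]_(m, n)) (Y : T -> 'M[R]_(k, n)) (t : R) : 0 < t -> mx_measurable Y ->
  (\int[P]_w (resid A (Y w) t)%:E)%E \is a fin_num.
Proof.
move=> t0 mY; apply: integrable_fin_num => //.
apply: (@bounded_integrable _ _ _ _ (\sum_i sqn (row i A)^T)).
  exact: measurable_resid.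
by move=> w; rewrite resid_ge0// resid_le.
Qed.

(** Dominated convergence: every residual is bounded by the squared Frobenius norm of [A]. *)
Lemma cvg_integral_resid d (T : measurableType d) (P : probability T R) k m n
    (A : 'M[R]_(m, n)) (Y : T -> 'M[R]_(k, n)) : mx_measurable Y ->
  fine (\int[P]_w (resid A (Y w) (harmonic N))%:E)%E @[N --> \oo] -->
  fine (\int[P]_w (resid0 A (Y w))%:E)%E.
Proof.
move=> mY; pose B : R := \sum_i sqn (row i A)^T.
have r0 w : 0 <= resid0 A (Y w).
  by apply: sumr_ge0 => i _; rewrite quad_projC sqn_ge0.
have rB w : resid0 A (Y w) <= B.
  by apply: ler_sum => i _; rewrite quadB quad1 lerBlDr lerDl quad_proj_ge0.
have fi : (\int[P]_w (resid0 A (Y w))%:E)%E \is a fin_num.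
  apply: integrable_fin_num => //; apply: (@bounded_integrable _ _ _ _ B).
    exact: measurable_resid0.
  by move=> w; rewrite r0 rB.
apply: fine_cvg; rewrite fineK//.
apply: (@dominated_cvg _ _ _ P setT measurableT
  (fun N w => (resid A (Y w) (harmonic N))%:E) _ (cst B%:E)) => //.
- move=> N; apply/measurable_EFinP; apply: measurable_resid => //.
  exact: harmonic_gt0.
- by move=> w _; apply: cvg_EFin; [exact: nearW|exact: cvg_resid].
- exact: finite_measure_integrable_cst.
- move=> N w _ /=; have h0 : 0 < harmonic N :> R by exact: harmonic_gt0.
  by rewrite lee_fin ger0_norm ?resid_ge0// resid_le.
Qed.

Lemma ErrE d (T : measurableType d) (P : probability T R) j m n (A : 'M[R]_(m, n))
    (S : 'I_j -> 'I_m -> {RV P >-> R}) :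
  Err A S = fine (\int[P]_w (resid0 A (rmx S w *m A))%:E)%E.
Proof.
rewrite /Err unlock; congr fine; apply: eq_integral => w _.
by rewrite -frob_norm_resid0.
Qed.

End ExpectedProjector.

(** * Quadratic form of the expected projector *)

Section SmallestEigenvalue.
Context {R : realType}.

Lemma cvgn_ge (u_ : R^nat) (l a : R) :
  u_ N @[N --> \oo] --> l -> (forall N, a <= u_ N) -> a <= l.
Proof.
move=> ul au; rewrite -(cvg_lim _ ul)//; apply: limr_ge; last exact: nearW.
by apply/cvg_ex; exists l.
Qed.

Lemma quadN n (N : 'M[R]_n) v : quad N (- v) = quad N v.
Proof. by rewrite /quad [(- v)^T]linearN/= mulNmx mulmxN mulNmx opprK. Qed.

Lemma quad_mulmx n p (N : 'M[R]_n) (B : 'M[R]_(n, p)) v :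
  quad N (B *m v) = quad (B^T *m N *m B) v.
Proof. by rewrite /quad trmx_mul !mulmxA. Qed.

(** As [rproj] is dominated by [proj], every regularized bound [L N] is already below [p], and the
    limit is taken on the side of the explicit bound. *)
Lemma expectation_proj_ge d (T : measurableType d) (P : probability T R)
    d' (T' : measurableType d') (P' : probability T' R) k m n
    (X : T -> 'M[R]_(k.+1, m)) (X' : T' -> 'M[R]_(k, m)) (A : 'M[R]_(m, n))
    (u : 'cV[R]_m) (v : 'cV[R]_n) (s : R) :
  gauss_matrix P X -> gauss_matrix P' X' ->
  sqn u = 1 -> sqn v = 1 -> 0 < s -> A *m v = s *: u -> A^T *m u = s *: v ->
  (3 + fine (\int[P']_w (resid0 A (X' w *m A))%:E)%E / (s ^+ 2 * k.+1%:R))^-1 <=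
  quad (expectation_mx P (fun w => proj (X w *m A))) v.
Proof.
move=> gX gX' u1 v1 s0 Av Atu; set E := fine _; set p := quad _ v.
have mXA := mx_measurable_mulr A (gauss_matrix_measurable gX).
have mXA' := mx_measurable_mulr A (gauss_matrix_measurable gX').
pose e N := fine (\int[P']_w (resid A (X' w *m A) (harmonic N))%:E)%E.
have eE : e N @[N --> \oo] --> E by exact: cvg_integral_resid.
have e0 N : 0 <= e N.
  by apply/fine_ge0/integral_ge0 => w _; rewrite lee_fin resid_ge0// harmonic_gt0.
have E0 : 0 <= E.
  exact: cvgn_ge eE e0.
pose K := s ^+ 2 * k.+1%:R; have K0 : 0 < K by rewrite mulr_gt0 ?exprn_gt0.
have D0 : 0 < 3 + E / K by rewrite ltr_pwDl// divr_ge0// ltW.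
(* The optimal tangent point for the limiting value [3 + E / K]; it does not depend on [N], so [L N]
   is affine in the converging quantities. *)
pose c := (3 + E / K)^-1; have c0 : 0 <= c by rewrite invr_ge0 ltW.
pose L N := 2 * c - c ^+ 2 * (3 + (harmonic N / moment2 + e N) / K).
have Lp N : L N <= p.
  have h0 : 0 < harmonic N :> R by exact: harmonic_gt0.
  have eN : (\int[P']_w (resid A (X' w *m A) (harmonic N))%:E)%E = (e N)%:E.
    by rewrite fineK//; exact: resid_integral_fin.
  rewrite -lee_fin; apply: le_trans (sketch_bound gX gX' u1 v1 s0 h0 c0 Av Atu eN) _.
  rewrite /p -quad_expectation_proj//; apply: ge0_le_integral => //.
  - by move=> w _; rewrite lee_fin quad_rproj_ge0.
  - apply/measurable_EFinP; apply: measurable_quad; last exact: mx_measurable_cst.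
    exact: mx_measurable_rproj.
  - by apply/measurable_EFinP; exact: measurable_quad_proj.
  - by move=> w _; rewrite lee_fin quad_rproj_le.
have LE : L N @[N --> \oo] --> 2 * c - c ^+ 2 * (3 + (0 / moment2 + E) / K).
  apply: cvgB; first exact: cvg_cst.
  apply: cvgM; first exact: cvg_cst.
  apply: cvgD; first exact: cvg_cst.
  apply: cvgM; last exact: cvg_cst.
  apply: cvgD => //; apply: cvgM; last exact: cvg_cst.
  exact: cvg_harmonic.
have -> : (3 + E / K)^-1 = 2 * c - c ^+ 2 * (3 + (0 / moment2 + E) / K).
  have -> : 3 + (0 / moment2 + E) / K = c^-1 by rewrite mul0r add0r invrK.
  by rewrite -/c; field; rewrite invr_neq0// gt_eqF.
rewrite -lerN2; apply: (cvgn_ge (u_ := fun N => - L N)) => [|N]; last by rewrite lerN2.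
exact: cvgN.
Qed.

(** In the basis [V] the residual is a sum of the nonnegative diagonal entries of [1 - P_t] weighted
    by the eigenvalues [D], and these entries add up to at least [n - k] by [mxtrace_rproj_le]. *)
Lemma resid_ge m n k (A : 'M[R]_(m, n)) (Y : 'M[R]_(k, n)) (t b : R)
    (V : 'M[R]_n) (D : 'rV[R]_n) :
  0 < t -> V^T *m V = 1%:M -> A^T *m A = V *m diag_mx D *m V^T ->
  0 <= b -> (forall i, b <= D 0 i) -> b * (n%:R - k%:R) <= resid A Y t.
Proof.
move=> t0 VV AA b0 bD; set N := 1%:M - rproj Y t.
have -> : resid A Y t = \sum_i D 0 i * quad N (col i V).
  rewrite /resid mxtrace_mulC mulmxA AA -!mulmxA mxtrace_mulC -mulmxA.
  apply: eq_bigr => i _.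
  rewrite mul_diag_mx mxE; congr (_ * _).
  by rewrite colE quad_mulmx quad_delta.
apply: (@le_trans _ _ (b * \tr N)).
  rewrite ler_wpM2l// /N linearB/= mxtrace1 lerD2l lerN2.
  exact: mxtrace_rproj_le.
have -> : \tr N = \tr (V^T *m N *m V).
  by rewrite mxtrace_mulC mulmxA (mulmx1C VV) mul1mx.
rewrite mulr_sumr; apply: ler_sum => i _.
rewrite colE quad_mulmx quad_delta ler_wpM2r//.
by rewrite -quad_delta -quad_mulmx quad_rprojC_ge0.
Qed.

(* The sketch and its product with the reflection along [u] have the same law, and the reflection
   changes the sign of [v] in the projector. *)
Lemma expectation_proj_orthogonal d (T : measurableType d) (P : probability T R) k m n
    (X : T -> 'M[R]_(k, m)) (A : 'M[R]_(m, n)) (u : 'cV[R]_m) (v v' : 'cV[R]_n) (s : R) :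
  gauss_matrix P X -> sqn u = 1 -> sqn v = 1 ->
  A *m v = s *: u -> A^T *m u = s *: v -> v^T *m v' = 0 ->
  v^T *m expectation_mx P (fun w => proj (X w *m A)) *m v' = 0.
Proof.
move=> gX u1 v1 Av Atu vv'.
have mXA := mx_measurable_mulr A (gauss_matrix_measurable gX).
set M := expectation_mx _ _; have MT : M^T = M by exact: tr_expectation_proj.
have vv := unit_vectorE v1.
pose J : 'M[R]_n := 1%:M - 2 *: (v *m v^T).
have JT : J^T = J by rewrite /J linearB/= linearZ/= trmx1 trmx_mul trmxK.
have Jv : J *m v = - v.
  rewrite mulmxBl mul1mx -scalemxAl -mulmxA vv mulmx1.
  by apply/matrixP => i j; rewrite !mxE; ring.
have Jv' : J *m v' = v' by rewrite mulmxBl mul1mx -scalemxAl -mulmxA vv' mulmx0 scaler0 subr0.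
have JJ : J *m J^T = 1%:M.
  rewrite JT {2}/J mulmxBr mulmx1 -scalemxAr mulmxA Jv mulNmx scalerN opprK.
  by rewrite /J subrK.
(* The reflection along [u] on the left of [A] becomes the reflection along [v] on its right, since
   [u u^T A = s u v^T = A v v^T]. *)
have BA : (1%:M - 2 *: (u *m u^T)) *m A = A *m J.
  rewrite mulmxBl mul1mx mulmxBr mulmx1 -scalemxAl -scalemxAr; congr (_ - _ *: _).
  rewrite -mulmxA [RHS]mulmxA Av -[u^T *m A]trmxK trmx_mul trmxK Atu.
  by rewrite [(_ *: _)^T]linearZ/= -scalemxAl -scalemxAr.
pose F (Y : 'M[R]_(k, m)) : \bar R := (quad (proj (Y *m A)) (v + v'))%:E.
have mF d' (T' : measurableType d') (Y : T' -> 'M[R]_(k, m)) : mx_measurable Y ->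
    measurable_fun setT (fun w => F (Y w)).
  move=> mY; apply/measurable_EFinP; apply: measurable_quad_proj.
  exact: mx_measurable_mulr.
have F0 Y : (0 <= F Y)%E by rewrite lee_fin quad_proj_ge0.
(* Reflecting turns [v + v'] into [- (v - v')], so the mean forms at [v + v'] and [v - v'] agree; by
   polarization the bilinear term vanishes. *)
have := gauss_reflection_integral gX u1 mF F0; rewrite /F {F mF F0}.
have -> : (\int[P]_w (quad (proj (X w *m (1%:M - 2 *: (u *m u^T)) *m A)) (v + v'))%:E =
    \int[P]_w (quad (proj (X w *m A)) (v - v'))%:E)%E.
  apply: eq_integral => w _; congr (_%:E).
  rewrite -mulmxA BA mulmxA proj_orthogonal// -quad_mulmx mulmxDr Jv Jv'.
  have -> : - v + v' = - (v - v') by rewrite opprB addrC.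
  exact: quadN.
rewrite !quad_expectation_proj// -/M => -[E].
apply/matrixP => i j; rewrite !ord1 [RHS]mxE.
apply: (@mulfI _ (4 : R)) => //.
by rewrite -quad_polarization// E subrr mulr0.
Qed.

(** Full column rank makes every eigenvalue of [A^T A] positive, so [u = A v / s] can be formed with
    [s] its square root. *)
Lemma singular_vectors m n (A : 'M[R]_(m, n)) : \rank A = n ->
  exists (V : 'M[R]_n) (D : 'rV[R]_n),
    [/\ V^T *m V = 1%:M, A^T *m A = V *m diag_mx D *m V^T &
        forall i, exists (u : 'cV[R]_m) (s : R),
          [/\ sqn u = 1, 0 < s, D 0 i = s ^+ 2,
              A *m col i V = s *: u & A^T *m u = s *: col i V]].
Proof.
move=> rA; have AAT : (A^T *m A)^T = A^T *m A by rewrite trmx_mul trmxK.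
have [V [D [VV AA]]] := symmetric_diagonalization AAT.
exists V, D; split => // i.
pose v : 'cV[R]_n := V *m delta_mx i 0; rewrite colE -/v.
have v1 : sqn v = 1.
  rewrite -sqnE trmx_mul -mulmxA (mulmxA V^T) VV mul1mx trmx_delta mul_delta_mx.
  by rewrite mxE !eqxx.
have AAv : A^T *m A *m v = D 0 i *: v.
  rewrite AA /v -!mulmxA (mulmxA V^T) VV mul1mx scalemxAr; congr (_ *m _).
  apply/matrixP => a b; rewrite mul_diag_mx !mxE ord1 eqxx andbT.
  by have [->//|ai] := eqVneq a i; rewrite !mulr0.
have AvD : sqn (A *m v) = D 0 i.
  by rewrite -sqnE trmx_mul -mulmxA (mulmxA A^T) AAv -scalemxAr scalemxE sqnE v1 mulr1.
have D0 : 0 < D 0 i.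
  rewrite lt_neqAle -{2}AvD sqn_ge0 andbT eq_sym; apply/eqP => Di0.
  have Av0 : A *m v = 0 by apply: sqn_eq0; rewrite AvD.
  have fA : row_free A^T by rewrite /row_free mxrank_tr rA.
  have vT0 : v^T = 0.
    by apply: (row_free_inj fA); rewrite mul0mx -trmx_mul Av0 trmx0.
  move: v1; rewrite -sqnE vT0 mul0mx mxE => /esym/eqP.
  by rewrite oner_eq0.
pose s := Num.sqrt (D 0 i); have s0 : 0 < s by rewrite sqrtr_gt0.
have s2 : s ^+ 2 = D 0 i by rewrite sqr_sqrtr// ltW.
have sn0 : s != 0 by rewrite gt_eqF.
exists (s^-1 *: (A *m v)), s; split => //.
- rewrite -sqnE [(_ *: _)^T]linearZ/= -scalemxAl -scalemxAr !scalemxE sqnE AvD -s2.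
  by field.
- by rewrite scalerA divff// scale1r.
- rewrite -scalemxAr mulmxA AAv scalerA -s2; congr (_ *: _).
  by field.
Qed.

End SmallestEigenvalue.

(** * From the quadratic form to the stated rate *)

Section FinalBound.
Context {R : realType}.

Lemma dot_col n p (V : 'M[R]_(n, p)) i j :
  ((col i V)^T *m col j V) 0 0 = (V^T *m V) i j.
Proof. by rewrite !mxE; apply: eq_bigr => l _; rewrite !mxE. Qed.

Lemma frob_norm_sqn n (v : 'cV[R]_n) : frob_norm v = Num.sqrt (sqn v).
Proof. by congr Num.sqrt; apply: eq_bigr => i _; rewrite big_ord1. Qed.

(** The given pair shows that the set of singular values is nonempty, so its [inf] is a genuine
    infimum. *)
Lemma sigma_min_bounds m n (A : 'M[R]_(m, n)) (u : 'cV[R]_m) (v : 'cV[R]_n) (s : R) :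
  sqn u = 1 -> sqn v = 1 -> 0 < s -> A *m v = s *: u -> A^T *m u = s *: v ->
  0 <= sigma_min A <= s.
Proof.
move=> u1 v1 s0 Av Atu.
have sA : singular_value A s.
  by split; [exact: ltW|exists u, v; rewrite !frob_norm_sqn u1 v1 sqrtr1].
have lb0 : lbound [set s | singular_value A s] 0 by move=> x [].
apply/andP; split; first by apply: lb_le_inf => //; exists s.
by apply: ge_inf => //; exists 0.
Qed.

Lemma lambda_min_ge n (M V : 'M[R]_n) (b : R) : (0 < n)%N -> V^T *m V = 1%:M ->
  (forall i j, i != j -> (col i V)^T *m M *m col j V = 0) ->
  (forall i, b <= quad M (col i V)) -> b <= lambda_min M.
Proof.
move=> n0 VV offdiag bM; have VVT := mulmx1C VV.
pose p := \row_i quad M (col i V).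
have pE : V^T *m M *m V = diag_mx p.
  apply/matrixP => i j; rewrite !mxE.
  have -> : \sum_l (V^T *m M) i l * V l j = ((col i V)^T *m M *m col j V) 0 0.
    rewrite mxE; apply: eq_bigr => l _; rewrite [col j V l 0]mxE; congr (_ * _).
    by rewrite tr_col -row_mul [RHS]mxE.
  have [->|ij] := eqVneq i j; first by rewrite mulr1n.
  by rewrite offdiag// mxE mulr0n.
(* The set of eigenvalues must be shown nonempty, as [inf] of the empty set is a default value; here
   [0 < n] enters. Every eigenvalue is then one of the diagonal entries [p 0 j]. *)
apply: lb_le_inf => [|a /= /eigenvalueP[w wM w0]].
  pose i0 := Ordinal n0; exists (p 0 i0) => /=; apply/eigenvalueP.
  exists (row i0 V^T).
    rewrite -row_mul.
    have -> : V^T *m M = diag_mx p *m V^T by rewrite -pE -mulmxA VVT mulmx1.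
    by apply/rowP => j; rewrite !mxE (bigD1 i0)//= big1 ?addr0 ?mxE ?eqxx ?mulr1n
      => [|l /negPf li]; rewrite ?mxE// eq_sym li mulr0n mul0r.
  apply/negP => /eqP V0; have /matrixP/(_ i0 i0) := VV.
  rewrite -[(V^T *m V) _ _]/((V^T *m V) i0 i0) !mxE big1 ?eqxx.
    by move/esym/eqP; rewrite oner_eq0.
  move=> l _; have /rowP/(_ l) := V0; rewrite !mxE => ->.
  by rewrite mul0r.
have [x xE x0] : exists2 x : 'rV[R]_n, x *m diag_mx p = a *: x & x != 0.
  exists (w *m V).
    by rewrite -pE !mulmxA -(mulmxA w) VVT mulmx1 wM scalemxAl.
  apply: contraNneq w0 => wV0.
  by rewrite -[w]mulmx1 -VVT mulmxA wV0 mul0mx.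
have /rV0Pn[j xj0] := x0.
have /rowP/(_ j) := xE; rewrite mul_mx_diag !mxE mulrC => /(mulIf xj0) <-.
exact: bM.
Qed.

Lemma rate_bound (n k : nat) (E s sg : R) : (1 <= k <= n)%N ->
  0 <= sg <= s -> 0 < s -> sg ^+ 2 * (n%:R - k%:R + 1) <= E ->
  (1 - (4 * k%:R / n%:R + 8 * ln (3 * n%:R) / n%:R)) * (k%:R * sg ^+ 2 / E) <=
  (3 + E / (s ^+ 2 * k%:R))^-1.
Proof.
move=> /andP[k1 kn] /andP[sg0 sgs] s0 hE.
set eps : R := _ / _ + _.
have k0 : 0 < k%:R :> R by rewrite ltr0n.
have n0 : 0 < n%:R :> R by rewrite ltr0n (leq_trans k1).
have nk : 0 < n%:R - k%:R + 1 :> R by rewrite ltr_wpDl// subr_ge0 ler_nat.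
have E0 : 0 <= E by apply: le_trans hE; rewrite mulr_ge0 ?sqr_ge0// ltW.
have rhs0 : 0 <= (3 + E / (s ^+ 2 * k%:R))^-1.
  by rewrite invr_ge0 addr_ge0// divr_ge0// mulr_ge0 ?sqr_ge0// ltW.
(* For [sg = 0] the left-hand side is 0, even if [E = 0]; otherwise [E > 0]. *)
have [->|sgn0] := eqVneq sg 0; first by rewrite expr0n/= mulr0 mul0r mulr0.
have sgp : 0 < sg by rewrite lt_neqAle eq_sym sgn0.
have Ep : 0 < E by apply: lt_le_trans hE; rewrite mulr_gt0// exprn_gt0.
pose q := k%:R * sg ^+ 2 / E; rewrite -/q.
have q0 : 0 < q by rewrite divr_gt0// mulr_gt0// exprn_gt0.
have [eps1|eps1] := leP 1 eps.
  by apply: le_trans rhs0; rewrite mulr_le0_ge0 ?(ltW q0)// subr_le0.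
have eps4 : 4 * k%:R / n%:R <= eps.
  rewrite /eps lerDl divr_ge0 ?(ltW n0)// mulr_ge0// ln_ge0//.
  have : 1 <= n%:R :> R by rewrite ler1n (leq_trans k1).
  by move=> n1; lra.
have k4 : 4 * k%:R < n%:R :> R.
  by have := le_lt_trans eps4 eps1; rewrite ltr_pdivrMr// mul1r.
have qk : q <= k%:R / (n%:R - k%:R + 1).
  rewrite /q ler_pdivrMr// mulrAC ler_pdivlMr// -mulrA ler_wpM2l ?(ltW k0)//.
(* The comparison amounts to [3 n <= 4 (n - k + 1)], that is [4 k <= n + 4], which [k4] implies. *)
have q4 : 3 * q <= 4 * k%:R / n%:R.
  have : 3 * (k%:R / (n%:R - k%:R + 1)) <= 4 * k%:R / n%:R :> R.
    rewrite ler_pdivlMr// mulrA mulrAC ler_pdivrMr//.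
    by nra.
  by apply: le_trans; rewrite ler_wpM2l.
have qs : q / (1 + 3 * q) <= (3 + E / (s ^+ 2 * k%:R))^-1.
  have qV : q^-1 = E / (sg ^+ 2 * k%:R) by rewrite /q invf_div (mulrC k%:R).
  have -> : q / (1 + 3 * q) = (3 + q^-1)^-1.
    move: (q) q0 => p p0; field.
    by rewrite !gt_eqF//; lra.
  have K0 : 0 < sg ^+ 2 * k%:R by rewrite mulr_gt0// exprn_gt0.
  have K1 : 0 < s ^+ 2 * k%:R by rewrite mulr_gt0// exprn_gt0.
  rewrite qV lef_pV2 ?posrE ?ltr_pwDl ?divr_ge0 ?(ltW K0) ?(ltW K1)//.
  rewrite lerD2l ler_wpM2l// lef_pV2 ?posrE// ler_wpM2r ?(ltW k0)//.
  by rewrite ler_pXn2r// nnegrE ltW.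
apply: le_trans qs; rewrite ler_pdivlMr; last by rewrite addr_gt0// mulr_gt0.
(* It remains to see that [(1 - eps) q (1 + 3 q) <= q], which follows from
   [(1 - 3 q) (1 + 3 q) <= 1]. *)
have : 1 - eps <= 1 - 3 * q by lra.
by nra.
Qed.

End FinalBound.

Theorem theorem3p1 (R : realType) (m n k : nat) (A : 'M[R]_(m, n))
    (d : measure_display) (T : measurableType d) (Pr : probability T R)
    (S : 'I_k -> 'I_m -> {RV Pr >-> R})
    (d' : measure_display) (T' : measurableType d') (Pr' : probability T' R)
    (S' : 'I_k.-1 -> 'I_m -> {RV Pr' >-> R})
    (rankA : \rank A = n) (hk : (1 <= k <= n)%N)
    (gaussS : gaussian_mx S) (gaussS' : gaussian_mx S') :
  exists2 eps : R,
    eps <= 4 * k%:R / n%:R + 8 * ln (3 * n%:R) / n%:R &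
    lambda_min (expectation_mx Pr (sketch_proj S A)) >=
      (1 - eps) * (k%:R * sigma_min A ^+ 2 / Err A S').
Proof.
(* The largest admissible [eps], for which the lower bound is weakest. *)
exists (4 * k%:R / n%:R + 8 * ln (3 * n%:R) / n%:R) => //.
case: k S S' hk gaussS gaussS' => [//|k] S /= S' hk gaussS gaussS'.
have n0 : (0 < n)%N by exact: leq_trans hk.
have gS := gaussian_mx_gauss_matrix gaussS.
have gS' : gauss_matrix Pr' (rmx S') := gaussian_mx_gauss_matrix gaussS'.
have [V [D [VV AA uD]]] := singular_vectors rankA.
have v1 i : sqn (col i V) = 1.
  by rewrite -sqnE dot_col VV mxE eqxx.
have sb i (u : 'cV[R]_m) s : sqn u = 1 -> 0 < s -> A *m col i V = s *: u ->
    A^T *m u = s *: col i V -> 0 <= sigma_min A <= s.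
  by move=> u1; exact: sigma_min_bounds.
(* From here on the sketch has [k.+1] rows and [S'] has [k], so [resid_ge] yields the factor
   [n - k = n - (k + 1) + 1]; it passes to [Err] in the limit of vanishing regularization. *)
have EE : sigma_min A ^+ 2 * (n%:R - k.+1%:R + 1) <= Err A S'.
  have -> : n%:R - k.+1%:R + 1 = n%:R - k%:R :> R by rewrite -natr1; ring.
  have mXA' := mx_measurable_mulr A (gauss_matrix_measurable gS').
  rewrite ErrE; apply: (cvgn_ge (cvg_integral_resid mXA')) => N.
  have h0 : 0 < harmonic N :> R by exact: harmonic_gt0.
  rewrite -lee_fin fineK; last exact: resid_integral_fin.
  rewrite -(probability_integral_cst Pr'); apply: ge0_le_integral => //.
  - by move=> w _; rewrite lee_fin mulr_ge0 ?sqr_ge0// subr_ge0 ler_nat ltnW.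
  - by apply/measurable_EFinP; exact: measurable_resid.
  - move=> w _; rewrite lee_fin; apply: (resid_ge _ h0 VV AA); first exact: sqr_ge0.
    move=> i; have [u [s [u1 s0 -> Av Atu]]] := uD i.
    have /andP[sg0 sgs] := sb _ _ _ u1 s0 Av Atu.
    by rewrite ler_pXn2r// nnegrE ltW.
apply: (lambda_min_ge n0 VV) => [i j ij|i].
  have [u [s [u1 s0 _ Av Atu]]] := uD i.
  apply: (expectation_proj_orthogonal gS u1 (v1 i) Av Atu).
  apply/matrixP => a b; rewrite !ord1 dot_col VV !mxE.
  by rewrite (negPf ij).
have [u [s [u1 s0 _ Av Atu]]] := uD i.
apply: le_trans (rate_bound (k := k.+1) hk (sb _ _ _ u1 s0 Av Atu) s0 EE) _.
by rewrite ErrE; exact: expectation_proj_ge gS gS' u1 (v1 i) s0 Av Atu.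
Qed.
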